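(* The functor $\Gamma_f:\mathbf{fuAlg}\to\mathbf{fMV}$, defined on objects by $\Gamma_f(V,u)=[0,u]_V$ and on morphisms $g:(V_1,u_1)\to(V_2,u_2)$ by $\Gamma_f(g)=g|_{[0,u_1]}$, establishes a categorical equivalence between the category $\mathbf{fuAlg}$ of fu-algebras and the category $\mathbf{fMV}$ of fMV-algebras.
   Context: An MV-algebra is a structure $(A,\oplus,{}^*,0)$ with $(A,\oplus,0)$ a commutative monoid, $(x^* )^*=x$, $x\oplus 0^*=0^*$ and $(x^*\oplus y)^*\oplus y=(y^*\oplus x)^*\oplus x$; put $1=0^*$, $x\odot y=(x^*\oplus y^* )^*$, order $x\le y$ iff $x\odot y^*=0$ (a lattice order, $x\wedge y=x\odot(x^*\oplus y)$). A PMVf-algebra is an MV-algebra with an associative binary operation $\cdot$ satisfying $z\cdot(x\odot(x\wedge y)^* )=(z\cdot x)\odot(z\cdot(x\wedge y))^*$, $(x\odot(x\wedge y)^* )\cdot z=(x\cdot z)\odot((x\wedge y)\cdot z)^*$, and: $x\wedge y=0$ implies $(x\cdot z)\wedge y=(z\cdot x)\wedge y=0$. A Riesz MV-algebra is an MV-algebra with unary operations $x\mapsto\alpha x$ ($\alpha\in[0,1]$) with $\alpha(x\odot y^* )=(\alpha x)\odot(\alpha y)^*$, $\max(0,\alpha-\beta)x=(\alpha x)\odot(\beta x)^*$, $\alpha(\beta x)=(\alpha\beta)x$, $1x=x$. An fMV-algebra is a structure $(A,\oplus,\cdot,{}^*,\{\alpha\}_{\alpha\in[0,1]},0)$ which is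 a PMVf-algebra and a Riesz MV-algebra (sharing the MV-structure) with $\alpha(x\cdot y)=(\alpha x)\cdot y=x\cdot(\alpha y)$; morphisms of $\mathbf{fMV}$ are maps preserving all operations. An f-algebra is a Riesz space (real vector lattice) $V$ with an associative bilinear product $\cdot$ making it a lattice-ordered ring ($x,y\ge0\Rightarrow x\cdot y\ge 0$) such that $x\wedge y=0$ and $z\ge0$ imply $(x\cdot z)\wedge y=(z\cdot x)\wedge y=0$, and $r(x\cdot y)=(rx)\cdot y=x\cdot(ry)$ for $r\in\mathbb R$. A strong unit is an element $u>0$ such that for every $x\in V$ there is $n\in\mathbb N$ with $x\le nu$. An fu-algebra is a pair $(V,u)$ with $V$ an f-algebra and $u$ a strong unit with $u\cdot u\le u$; morphisms of $\mathbf{fuAlg}$ are f-algebra homomorphisms (linear lattice ring homomorphisms) $g$ with $g(u_1)=u_2$. $[0,u]_V$ is the set $\{x\in V:0\le x\le u\}$ with $x\oplus y=u\wedge(x+y)$, $x^*=u-x$, $0$, the restriction of the product of $V$ and the scalar multiplication by $\alpha\in[0,1]$; it is an fMV-algebra.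
   Formalization: A strong unit is only required to satisfy u ≥ 0 rather than u > 0, which adds just the zero space V = {0}; with u > 0 the one-element fMV-algebra (0 = 1) would not be isomorphic to any [0,u]. *)

(* Defs.v *)
From HB Require Import structures.
From mathcomp Require Import all_boot all_order all_algebra.
From mathcomp Require Import interval_inference boolp reals.

Set Implicit Arguments.
Unset Strict Implicit.
Unset Printing Implicit Defensive.

Import Order.TTheory GRing.Theory Num.Theory.

Local Open Scope ring_scope.

Declare Scope mv_scope.
Delimit Scope mv_scope with MV.
Declare Scope riesz_scope.
Delimit Scope riesz_scope with RS.

(** * MV-algebras and their expansions *)

(* The commutative monoid (A, ⊕, 0) of an MV-algebra is the nmodType of A, so
   that ⊕ is written +. *)
HB.mixin Record Nmodule_isMVAlgebra A of GRing.Nmodule A := {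
  mvneg : A -> A;
  mvnegK : involutive mvneg;
  mvaddr1 : forall x : A, x + mvneg 0 = mvneg 0;
  mvlukasiewicz : forall x y : A,
    mvneg (mvneg x + y) + y = mvneg (mvneg y + x) + x
}.

#[short(type="mvAlgType")]
HB.structure Definition MVAlgebra :=
  {A of Nmodule_isMVAlgebra A & GRing.Nmodule A}.

Definition mvmul (A : mvAlgType) (x y : A) : A := mvneg (mvneg x + mvneg y).

Definition mvmeet (A : mvAlgType) (x y : A) : A := mvmul x (mvneg x + y).

Notation "x ^*" := (mvneg x) : mv_scope.
Notation "x ⊙ y" := (mvmul x y) (at level 40, left associativity) : mv_scope.
Notation "x ⊓ y" := (mvmeet x y) (at level 48, left associativity) : mv_scope.

HB.mixin Record MVAlgebra_isPMVf A of MVAlgebra A := {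
  pmul : A -> A -> A;
  pmulA : associative pmul;
  pmulBr : forall x y z : A,
    (pmul z (x ⊙ (x ⊓ y)^*) = pmul z x ⊙ (pmul z (x ⊓ y))^*)%MV;
  pmulBl : forall x y z : A,
    (pmul (x ⊙ (x ⊓ y)^*) z = pmul x z ⊙ (pmul (x ⊓ y) z)^*)%MV;
  pmul_disjointr : forall x y z : A,
    (x ⊓ y)%MV = 0 -> (pmul x z ⊓ y)%MV = 0;
  pmul_disjointl : forall x y z : A,
    (x ⊓ y)%MV = 0 -> (pmul z x ⊓ y)%MV = 0
}.

#[short(type="pmvfAlgType")]
HB.structure Definition PMVfAlgebra := {A of MVAlgebra A & MVAlgebra_isPMVf A}.

HB.mixin Record MVAlgebra_isRieszMV (R : realType) A of MVAlgebra A := {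
  mvscale : {i01 R} -> A -> A;
  mvscaleBr : forall (a : {i01 R}) (x y : A),
    (mvscale a (x ⊙ y^*) = mvscale a x ⊙ (mvscale a y)^*)%MV;
  mvscaleBl : forall (a b : {i01 R}) (x : A),
    mvscale (Num.max 0 (a%:num - b%:num))%:i01 x =
    (mvscale a x ⊙ (mvscale b x)^*)%MV;
  mvscaleA : forall (a b : {i01 R}) (x : A),
    mvscale a (mvscale b x) = mvscale (a%:num * b%:num)%:i01 x;
  mvscale1 : forall x : A, mvscale 1%:i01 x = x
}.

#[short(type="rieszMVAlgType")]
HB.structure Definition RieszMVAlgebra (R : realType) :=
  {A of MVAlgebra A & MVAlgebra_isRieszMV R A}.

HB.mixin Record PMVf_RieszMV_isFMV (R : realType) A
    of PMVfAlgebra A & RieszMVAlgebra R A := {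
  mvscale_pmull : forall (a : {i01 R}) (x y : A),
    mvscale a (pmul x y) = pmul (mvscale a x) y;
  mvscale_pmulr : forall (a : {i01 R}) (x y : A),
    mvscale a (pmul x y) = pmul x (mvscale a y)
}.

#[short(type="fmvAlgType")]
HB.structure Definition FMVAlgebra (R : realType) :=
  {A of PMVfAlgebra A & RieszMVAlgebra R A & PMVf_RieszMV_isFMV R A}.

Record fmv_hom (R : realType) (A B : fmvAlgType R) := FMVHom {
  fmv_map :> A -> B;
  fmv_mapD : {morph fmv_map : x y / x + y};
  fmv_mapM : {morph fmv_map : x y / pmul x y};
  fmv_mapN : {morph fmv_map : x / mvneg x};
  fmv_mapZ : forall a : {i01 R}, {morph fmv_map : x / mvscale a x};
  fmv_map0 : fmv_map 0 = 0
}.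

(** * Riesz spaces, f-algebras and fu-algebras *)

(* The lattice operations are carried by this mixin because Hierarchy Builder
   rejects a common descendant of Order.Lattice and GRing.Zmodule declared after
   Num.RealDomain. *)
HB.mixin Record POrderedLmodule_isRieszSpace (R : realType) V
    of Num.POrderedZmodule V & GRing.Lmodule R V := {
  riesz_meet : V -> V -> V;
  riesz_join : V -> V -> V;
  riesz_lexI : forall x y z : V,
    (z <= riesz_meet x y) = (z <= x) && (z <= y);
  riesz_leUx : forall x y z : V,
    (riesz_join x y <= z) = (x <= z) && (y <= z);
  riesz_leD2l : forall x y z : V, x <= y -> z + x <= z + y;
  riesz_leZ2l : forall (a : R) (x y : V), 0 <= a -> x <= y -> a *: x <= a *: y
}.

#[short(type="rieszSpaceType")]
HB.structure Definition RieszSpace (R : realType) :=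
  {V of Num.POrderedZmodule V & GRing.Lmodule R V
      & POrderedLmodule_isRieszSpace R V}.

Notation "x ⊓ y" := (riesz_meet x y) : riesz_scope.
Notation "x ⊔ y" := (riesz_join x y)
  (at level 52, left associativity) : riesz_scope.

(* The product of an f-algebra need not have a unit, hence it is not the
   product of a MathComp ring. *)
HB.mixin Record RieszSpace_isFAlgebra (R : realType) V of RieszSpace R V := {
  fmul : V -> V -> V;
  fmulA : associative fmul;
  fmulDl : left_distributive fmul +%R;
  fmulDr : right_distributive fmul +%R;
  fmulZl : forall (r : R) (x y : V), r *: fmul x y = fmul (r *: x) y;
  fmulZr : forall (r : R) (x y : V), r *: fmul x y = fmul x (r *: y);
  fmul_ge0 : forall x y : V, 0 <= x -> 0 <= y -> 0 <= fmul x y;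
  fmul_disjointr : forall x y z : V,
    (x ⊓ y)%RS = 0 -> 0 <= z -> (fmul x z ⊓ y)%RS = 0;
  fmul_disjointl : forall x y z : V,
    (x ⊓ y)%RS = 0 -> 0 <= z -> (fmul z x ⊓ y)%RS = 0
}.

#[short(type="fAlgType")]
HB.structure Definition FAlgebra (R : realType) :=
  {V of RieszSpace R V & RieszSpace_isFAlgebra R V}.

(* Positivity of u is 0 <= u: by strong_unit_gt0 below, this differs from 0 < u
   only for V = {0}, whose interval [0, u] is the MV-algebra with 0 = 1. *)
Definition strong_unit (R : realType) (V : rieszSpaceType R) (u : V) : Prop :=
  0 <= u /\ forall x : V, exists n : nat, x <= u *+ n.

Lemma strong_unit_gt0 (R : realType) (V : rieszSpaceType R) (u x : V) :
  strong_unit u -> x != 0 -> 0 < u.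
Proof.
case=> u_ge0 uP x_neq0; rewrite lt_neqAle u_ge0 andbT; apply/eqP => u0.
have le0 (y : V) : y <= 0 by have [n] := uP y; rewrite -u0 mul0rn.
move/negP: x_neq0; apply; rewrite eq_le le0 /=.
by have := riesz_leD2l (- x) 0 x (le0 (- x)); rewrite subrr addr0.
Qed.

Record fuAlg (R : realType) := FuAlg {
  fu_car :> fAlgType R;
  fu_unit : fu_car;
  fu_unit_strong : strong_unit fu_unit;
  fu_unit_sqr : fmul fu_unit fu_unit <= fu_unit
}.

Record fu_hom (R : realType) (V W : fuAlg R) := FuHom {
  fu_map :> V -> W;
  fu_map_linear : linear fu_map;
  fu_mapI : {morph fu_map : x y / (x ⊓ y)%RS};
  fu_mapU : {morph fu_map : x y / (x ⊔ y)%RS};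
  fu_mapM : {morph fu_map : x y / fmul x y};
  fu_map_unit : fu_map (fu_unit V) = fu_unit W
}.

(** * Categories, functors and equivalences *)

Record category := Category {
  obj :> Type;
  hom : obj -> obj -> Type;
  idm : forall a, hom a a;
  comp : forall a b c, hom b c -> hom a b -> hom a c;
  comp1m : forall a b (f : hom a b), comp (idm b) f = f;
  compm1 : forall a b (f : hom a b), comp f (idm a) = f;
  compmA : forall a b c d (h : hom c d) (g : hom b c) (f : hom a b),
    comp h (comp g f) = comp (comp h g) f
}.

Record functor (C D : category) := Functor {
  fobj :> C -> D;
  fmap : forall a b, hom a b -> hom (fobj a) (fobj b);
  fmap1 : forall a, fmap (idm a) = idm (fobj a);
  fmap_comp : forall a b c (g : hom b c) (f : hom a b),
    fmap (comp g f) = comp (fmap g) (fmap f)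
}.

Definition id_functor (C : category) : functor C C :=
  @Functor C C id (fun _ _ => id) (fun=> erefl) (fun _ _ _ _ _ => erefl).

Lemma comp_fmap1 (C D E : category) (G : functor D E) (F : functor C D) a :
  fmap G (fmap F (idm a)) = idm (G (F a)).
Proof. by rewrite !fmap1. Qed.

Lemma comp_fmap_comp (C D E : category) (G : functor D E) (F : functor C D)
    a b c (g : hom b c) (f : hom a b) :
  fmap G (fmap F (comp g f)) =
  comp (fmap G (fmap F g)) (fmap G (fmap F f)).
Proof. by rewrite !fmap_comp. Qed.

Definition comp_functor (C D E : category) (G : functor D E) (F : functor C D) :
    functor C E :=
  @Functor C E (fun a => G (F a)) (fun _ _ f => fmap G (fmap F f))
    (comp_fmap1 G F) (@comp_fmap_comp C D E G F).

Definition is_iso (C : category) (a b : C) (f : hom a b) : Prop :=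
  exists g : hom b a, comp g f = idm a /\ comp f g = idm b.

Definition naturally_isomorphic (C D : category) (F G : functor C D) : Prop :=
  exists eta : forall a, hom (F a) (G a),
    (forall a, is_iso (eta a)) /\
    (forall a b (f : hom a b),
       comp (eta b) (fmap F f) = comp (fmap G f) (eta a)).

Definition is_equivalence (C D : category) (F : functor C D) : Prop :=
  exists G : functor D C,
    naturally_isomorphic (id_functor C) (comp_functor G F) /\
    naturally_isomorphic (comp_functor F G) (id_functor D).

(** * The categories fMV and fuAlg *)

Lemma fmv_hom_ext (R : realType) (A B : fmvAlgType R) (f g : fmv_hom A B) :
  fmv_map f = fmv_map g -> f = g.
Proof.
case: f g => [f fD fM fN fZ f0] [g gD gM gN gZ g0] /= fg.
by subst g; congr FMVHom; exact: Prop_irrelevance.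
Qed.

Definition fmv_id (R : realType) (A : fmvAlgType R) : fmv_hom A A :=
  @FMVHom R A A id (fun _ _ => erefl) (fun _ _ => erefl) (fun=> erefl)
    (fun _ _ => erefl) erefl.

Definition fmv_comp (R : realType) (A B C : fmvAlgType R)
  (g : fmv_hom B C) (f : fmv_hom A B) : fmv_hom A C.
Proof.
apply: (@FMVHom R A C (g \o f)) => [x y|x y|x|a x|] /=.
- by rewrite !fmv_mapD.
- by rewrite !fmv_mapM.
- by rewrite !fmv_mapN.
- by rewrite !fmv_mapZ.
- by rewrite !fmv_map0.
Defined.

Definition fMV (R : realType) : category.
Proof.
apply: (@Category (fmvAlgType R) (@fmv_hom R) (@fmv_id R) (@fmv_comp R)).
- by move=> A B f; exact: fmv_hom_ext.
- by move=> A B f; exact: fmv_hom_ext.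
- by move=> A B C D h g f; exact: fmv_hom_ext.
Defined.

Lemma fu_hom_ext (R : realType) (V W : fuAlg R) (f g : fu_hom V W) :
  fu_map f = fu_map g -> f = g.
Proof.
case: f g => [f fL fI fU fM fu] [g gL gI gU gM gu] /= fg.
by subst g; congr FuHom; exact: Prop_irrelevance.
Qed.

Definition fu_id (R : realType) (V : fuAlg R) : fu_hom V V :=
  @FuHom R V V id (fun _ _ _ => erefl) (fun _ _ => erefl) (fun _ _ => erefl)
    (fun _ _ => erefl) erefl.

Definition fu_comp (R : realType) (U V W : fuAlg R)
  (g : fu_hom V W) (f : fu_hom U V) : fu_hom U W.
Proof.
apply: (@FuHom R U W (g \o f)) => [a x y|x y|x y|x y|] /=.
- by rewrite !fu_map_linear.
- by rewrite !fu_mapI.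
- by rewrite !fu_mapU.
- by rewrite !fu_mapM.
- by rewrite !fu_map_unit.
Defined.

Definition fuAlgCat (R : realType) : category.
Proof.
apply: (@Category (fuAlg R) (@fu_hom R) (@fu_id R) (@fu_comp R)).
- by move=> V W f; exact: fu_hom_ext.
- by move=> V W f; exact: fu_hom_ext.
- by move=> U V W X h g f; exact: fu_hom_ext.
Defined.

(** * The functor Γ_f *)

Local Open Scope riesz_scope.

Lemma riesz_leIl (R : realType) (V : rieszSpaceType R) (x y : V) : x ⊓ y <= x.
Proof. by have := riesz_lexI x y (x ⊓ y); rewrite lexx => /esym/andP[]. Qed.

Lemma riesz_leIr (R : realType) (V : rieszSpaceType R) (x y : V) : x ⊓ y <= y.
Proof. by have := riesz_lexI x y (x ⊓ y); rewrite lexx => /esym/andP[]. Qed.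

Lemma riesz_leUl (R : realType) (V : rieszSpaceType R) (x y : V) : x <= x ⊔ y.
Proof. by have := riesz_leUx x y (x ⊔ y); rewrite lexx => /esym/andP[]. Qed.

Lemma riesz_leUr (R : realType) (V : rieszSpaceType R) (x y : V) : y <= x ⊔ y.
Proof. by have := riesz_leUx x y (x ⊔ y); rewrite lexx => /esym/andP[]. Qed.

Lemma riesz_eq_meet (R : realType) (V : rieszSpaceType R) (x y m : V) :
  (forall z, (z <= m) = (z <= x) && (z <= y)) -> x ⊓ y = m.
Proof.
by move=> mP; apply: le_anti; rewrite mP riesz_leIl riesz_leIr riesz_lexI -mP /=.
Qed.

Lemma riesz_eq_join (R : realType) (V : rieszSpaceType R) (x y m : V) :
  (forall z, (m <= z) = (x <= z) && (y <= z)) -> x ⊔ y = m.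
Proof.
by move=> mP; apply: le_anti; rewrite mP riesz_leUl riesz_leUr riesz_leUx -mP lexx.
Qed.

Lemma riesz_meetC (R : realType) (V : rieszSpaceType R) (x y : V) :
  x ⊓ y = y ⊓ x.
Proof. by apply: riesz_eq_meet => z; rewrite riesz_lexI andbC. Qed.

Lemma riesz_joinC (R : realType) (V : rieszSpaceType R) (x y : V) :
  x ⊔ y = y ⊔ x.
Proof. by apply: riesz_eq_join => z; rewrite riesz_leUx andbC. Qed.

Lemma riesz_meetA (R : realType) (V : rieszSpaceType R) (x y z : V) :
  x ⊓ (y ⊓ z) = x ⊓ y ⊓ z.
Proof. by apply: riesz_eq_meet => t; rewrite !riesz_lexI andbA. Qed.

Lemma riesz_meet_l (R : realType) (V : rieszSpaceType R) (x y : V) :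
  x <= y -> x ⊓ y = x.
Proof.
move=> xy; apply: riesz_eq_meet => z.
by case zx: (z <= x) => //=; rewrite (le_trans zx).
Qed.

Lemma riesz_meet_r (R : realType) (V : rieszSpaceType R) (x y : V) :
  y <= x -> x ⊓ y = y.
Proof. by move=> yx; rewrite riesz_meetC riesz_meet_l. Qed.

Lemma riesz_join_r (R : realType) (V : rieszSpaceType R) (x y : V) :
  x <= y -> x ⊔ y = y.
Proof.
move=> xy; apply: riesz_eq_join => z.
by case yz: (y <= z); rewrite ?andbF ?andbT // (le_trans xy yz).
Qed.

Lemma riesz_leD2lE (R : realType) (V : rieszSpaceType R) (z x y : V) :
  (z + x <= z + y) = (x <= y).
Proof.
apply/idP/idP => [h|]; last exact: riesz_leD2l.
by have := riesz_leD2l _ _ (- z) h; rewrite !addKr.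
Qed.

Lemma riesz_subr_ge0 (R : realType) (V : rieszSpaceType R) (x y : V) :
  (0 <= y - x) = (x <= y).
Proof. by rewrite -(riesz_leD2lE x 0) addr0 addrC subrK. Qed.

Lemma riesz_leN2 (R : realType) (V : rieszSpaceType R) (x y : V) :
  (- x <= - y) = (y <= x).
Proof. by rewrite -(riesz_subr_ge0 (- x)) opprK addrC riesz_subr_ge0. Qed.

Lemma riesz_addr_ge0 (R : realType) (V : rieszSpaceType R) (x y : V) :
  0 <= x -> 0 <= y -> 0 <= x + y.
Proof. by move=> x0 y0; rewrite (le_trans x0)// -[leLHS]addr0 riesz_leD2lE. Qed.

Lemma riesz_addrI (R : realType) (V : rieszSpaceType R) (z x y : V) :
  z + x ⊓ y = (z + x) ⊓ (z + y).
Proof.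
have le_addr (t s : V) : (t <= z + s) = (- z + t <= s).
  by rewrite -(riesz_leD2lE z (- z + t)) addNKr.
by apply/esym/riesz_eq_meet => t; rewrite !le_addr riesz_lexI.
Qed.

Lemma riesz_addrU (R : realType) (V : rieszSpaceType R) (z x y : V) :
  z + (x ⊔ y) = (z + x) ⊔ (z + y).
Proof.
have ge_addr (t s : V) : (z + t <= s) = (t <= - z + s).
  by rewrite -(riesz_leD2lE z t) addNKr.
by apply/esym/riesz_eq_join => t; rewrite !ge_addr riesz_leUx.
Qed.

Lemma riesz_oppI (R : realType) (V : rieszSpaceType R) (x y : V) :
  - (x ⊓ y) = - x ⊔ - y.
Proof.
apply/esym/riesz_eq_join => t.
by rewrite -[t]opprK !riesz_leN2 riesz_lexI.
Qed.

Lemma riesz_scaleU (R : realType) (V : rieszSpaceType R) (a : R) (x y : V) :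
  0 <= a -> a *: (x ⊔ y) = (a *: x) ⊔ (a *: y).
Proof.
rewrite le_eqVlt => /predU1P[<-|a_gt0].
  by rewrite !scale0r riesz_join_r.
have leZ (z t : V) : (a *: z <= t) = (z <= a^-1 *: t).
  apply/idP/idP => [|h].
    have ai_ge0 : 0 <= a^-1 by rewrite invr_ge0 ltW.
    by move/(riesz_leZ2l _ _ _ ai_ge0); rewrite scalerA mulVf ?gt_eqF// scale1r.
  have := riesz_leZ2l _ _ _ (ltW a_gt0) h.
  by rewrite scalerA mulfV ?gt_eqF// scale1r.
by apply/esym/riesz_eq_join => t; rewrite !leZ riesz_leUx.
Qed.

Lemma riesz_oppU (R : realType) (V : rieszSpaceType R) (x y : V) :
  - (x ⊔ y) = - x ⊓ - y.
Proof. by apply: oppr_inj; rewrite riesz_oppI !opprK. Qed.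

Lemma riesz_subI (R : realType) (V : rieszSpaceType R) (z x : V) :
  z - (z ⊓ x) = 0 ⊔ (z - x).
Proof. by rewrite riesz_oppI riesz_addrU subrr. Qed.

Lemma fmulBl (R : realType) (V : fAlgType R) (x y z : V) :
  fmul (x - y) z = fmul x z - fmul y z.
Proof. by rewrite fmulDl -!scaleN1r fmulZl. Qed.

Lemma fmulBr (R : realType) (V : fAlgType R) (x y z : V) :
  fmul z (x - y) = fmul z x - fmul z y.
Proof. by rewrite fmulDr -!scaleN1r fmulZr. Qed.

Lemma fmul_le (R : realType) (V : fAlgType R) (x y z t : V) :
  0 <= x -> x <= z -> 0 <= y -> y <= t -> fmul x y <= fmul z t.
Proof.
move=> x0 xz y0 yt; apply: (@le_trans _ _ (fmul x t)).
  by rewrite -riesz_subr_ge0 -fmulBr fmul_ge0 // riesz_subr_ge0.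
by rewrite -riesz_subr_ge0 -fmulBl fmul_ge0 ?riesz_subr_ge0 // (le_trans y0).
Qed.

Record unit_interval (R : realType) (V : fuAlg R) := UnitInterval {
  ui_val : V;
  ui_bounds : (0 <= ui_val) && (ui_val <= fu_unit V)
}.

HB.instance Definition _ (R : realType) (V : fuAlg R) :=
  [isSub for @ui_val R V].
HB.instance Definition _ (R : realType) (V : fuAlg R) :=
  [Choice of unit_interval V by <:].

Lemma ui_val_inj (R : realType) (V : fuAlg R) : injective (@ui_val R V).
Proof. exact: val_inj. Qed.

Lemma ui_ge0 (R : realType) (V : fuAlg R) (x : unit_interval V) :
  0 <= ui_val x.
Proof. by case/andP: (ui_bounds x). Qed.

Lemma ui_le1 (R : realType) (V : fuAlg R) (x : unit_interval V) :
  ui_val x <= fu_unit V.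
Proof. by case/andP: (ui_bounds x). Qed.

Lemma fu_unit_ge0 (R : realType) (V : fuAlg R) : 0 <= fu_unit V.
Proof. by case: (fu_unit_strong V). Qed.

Lemma ui_zero_subproof (R : realType) (V : fuAlg R) :
  (0 <= 0 :> V) && (0 <= fu_unit V).
Proof. by rewrite lexx fu_unit_ge0. Qed.

Lemma ui_add_subproof (R : realType) (V : fuAlg R) (x y : unit_interval V) :
  let z := fu_unit V ⊓ (ui_val x + ui_val y) in (0 <= z) && (z <= fu_unit V).
Proof.
by rewrite /= riesz_leIl riesz_lexI fu_unit_ge0 riesz_addr_ge0 ?ui_ge0.
Qed.

Lemma ui_neg_subproof (R : realType) (V : fuAlg R) (x : unit_interval V) :
  let z := fu_unit V - ui_val x in (0 <= z) && (z <= fu_unit V).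
Proof.
rewrite /= riesz_subr_ge0 ui_le1 /= -[leRHS]addr0 riesz_leD2lE -oppr0.
by rewrite riesz_leN2 ui_ge0.
Qed.

Lemma ui_mul_subproof (R : realType) (V : fuAlg R) (x y : unit_interval V) :
  let z := fmul (ui_val x) (ui_val y) in (0 <= z) && (z <= fu_unit V).
Proof.
rewrite /= fmul_ge0 ?ui_ge0 //= (le_trans _ (fu_unit_sqr V)) //.
by apply: fmul_le; rewrite ?ui_ge0 ?ui_le1.
Qed.

Lemma ui_scale_subproof (R : realType) (V : fuAlg R) (a : {i01 R})
    (x : unit_interval V) :
  let z := a%:num *: ui_val x in (0 <= z) && (z <= fu_unit V).
Proof.
rewrite /=; apply/andP; split.
  by rewrite -(scaler0 V a%:num) riesz_leZ2l ?ui_ge0.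
rewrite (le_trans _ (ui_le1 x)) // -riesz_subr_ge0 -[X in X - _]scale1r -scalerBl.
by rewrite -(scaler0 V (1 - a%:num)) riesz_leZ2l ?ui_ge0.
Qed.

Definition ui_zero (R : realType) (V : fuAlg R) : unit_interval V :=
  UnitInterval (ui_zero_subproof V).
Definition ui_add (R : realType) (V : fuAlg R) (x y : unit_interval V) :
  unit_interval V := UnitInterval (ui_add_subproof x y).
Definition ui_neg (R : realType) (V : fuAlg R) (x : unit_interval V) :
  unit_interval V := UnitInterval (ui_neg_subproof x).
Definition ui_mul (R : realType) (V : fuAlg R) (x y : unit_interval V) :
  unit_interval V := UnitInterval (ui_mul_subproof x y).
Definition ui_scale (R : realType) (V : fuAlg R) (a : {i01 R})
  (x : unit_interval V) : unit_interval V :=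
  UnitInterval (ui_scale_subproof a x).

Lemma ui_addC (R : realType) (V : fuAlg R) : commutative (@ui_add R V).
Proof. by move=> x y; apply: ui_val_inj => /=; rewrite addrC. Qed.

Lemma ui_addA (R : realType) (V : fuAlg R) : associative (@ui_add R V).
Proof.
have h (x y z : unit_interval V) : ui_val (ui_add x (ui_add y z)) =
    fu_unit V ⊓ (ui_val x + (ui_val y + ui_val z)).
  rewrite /= riesz_addrI riesz_meetA (@riesz_meet_l _ _ (fu_unit V)) //.
  by rewrite addrC -[leLHS]addr0 riesz_leD2lE ui_ge0.
move=> x y z; apply: ui_val_inj.
by rewrite (ui_addC (ui_add x y)) !h addrA [ui_val z + _]addrC.
Qed.

Lemma ui_add0 (R : realType) (V : fuAlg R) :
  left_id (@ui_zero R V) (@ui_add R V).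
Proof.
by move=> x; apply: ui_val_inj; rewrite /= add0r riesz_meet_r ?ui_le1.
Qed.

HB.instance Definition _ (R : realType) (V : fuAlg R) :=
  GRing.isNmodule.Build (unit_interval V)
    (@ui_addA R V) (@ui_addC R V) (@ui_add0 R V).

Lemma ui_negK (R : realType) (V : fuAlg R) : involutive (@ui_neg R V).
Proof. by move=> x; apply: ui_val_inj; rewrite /= opprB addrC subrK. Qed.

Lemma ui_addr1 (R : realType) (V : fuAlg R) (x : unit_interval V) :
  x + ui_neg 0 = ui_neg 0.
Proof.
apply: ui_val_inj; rewrite /= subr0 riesz_meet_l //.
by rewrite addrC -[leLHS]addr0 riesz_leD2lE ui_ge0.
Qed.

Lemma ui_lukasiewicz (R : realType) (V : fuAlg R) (x y : unit_interval V) :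
  ui_neg (ui_neg x + y) + y = ui_neg (ui_neg y + x) + x.
Proof.
have h (a b : unit_interval V) :
    ui_val (ui_neg (ui_neg a + b) + b) = fu_unit V ⊓ (ui_val a ⊔ ui_val b).
  rewrite /= riesz_subI opprD opprB addrA subrKC (addrC _ (ui_val b)).
  by rewrite riesz_addrU addr0 subrKC riesz_joinC.
by apply: ui_val_inj; rewrite !h riesz_joinC.
Qed.

HB.instance Definition _ (R : realType) (V : fuAlg R) :=
  Nmodule_isMVAlgebra.Build (unit_interval V)
    (@ui_negK R V) (@ui_addr1 R V) (@ui_lukasiewicz R V).

Lemma ui_val_mvmul (R : realType) (V : fuAlg R) (x y : unit_interval V) :
  ui_val (x ⊙ y)%MV = 0 ⊔ (ui_val x - (fu_unit V - ui_val y)).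
Proof. by rewrite /= riesz_subI opprD opprB addrA subrKC opprB. Qed.

Lemma ui_valB (R : realType) (V : fuAlg R) (x y : unit_interval V) :
  ui_val (x ⊙ y^*)%MV = 0 ⊔ (ui_val x - ui_val y).
Proof. by rewrite ui_val_mvmul /= subKr. Qed.

Lemma ui_valI (R : realType) (V : fuAlg R) (x y : unit_interval V) :
  ui_val (x ⊓ y)%MV = ui_val x ⊓ ui_val y.
Proof.
rewrite ui_val_mvmul /= riesz_subI opprD opprB addrA subrKC.
rewrite riesz_oppU oppr0 opprB riesz_addrI addr0 subrKC.
by rewrite riesz_join_r // riesz_lexI !ui_ge0.
Qed.

Lemma ui_valM (R : realType) (V : fuAlg R) (x y : unit_interval V) :
  ui_val (ui_mul x y) = fmul (ui_val x) (ui_val y).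
Proof. by []. Qed.

Lemma ui_valZ (R : realType) (V : fuAlg R) (a : {i01 R})
    (x : unit_interval V) :
  ui_val (ui_scale a x) = a%:num *: ui_val x.
Proof. by []. Qed.

Lemma ui_mulA (R : realType) (V : fuAlg R) : associative (@ui_mul R V).
Proof. by move=> x y z; apply: ui_val_inj; rewrite /= fmulA. Qed.

Lemma ui_mulBr (R : realType) (V : fuAlg R) (x y z : unit_interval V) :
  (ui_mul z (x ⊙ (x ⊓ y)^*) = ui_mul z x ⊙ (ui_mul z (x ⊓ y))^*)%MV.
Proof.
apply: ui_val_inj; rewrite ui_valB !ui_valM ui_valB ui_valI -fmulBr.
have ge0 : 0 <= ui_val x - ui_val x ⊓ ui_val y.
  by rewrite riesz_subr_ge0 riesz_leIl.
by rewrite !riesz_join_r ?fmul_ge0 ?ui_ge0.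
Qed.

Lemma ui_mulBl (R : realType) (V : fuAlg R) (x y z : unit_interval V) :
  (ui_mul (x ⊙ (x ⊓ y)^*) z = ui_mul x z ⊙ (ui_mul (x ⊓ y) z)^*)%MV.
Proof.
apply: ui_val_inj; rewrite ui_valB !ui_valM ui_valB ui_valI -fmulBl.
have ge0 : 0 <= ui_val x - ui_val x ⊓ ui_val y.
  by rewrite riesz_subr_ge0 riesz_leIl.
by rewrite !riesz_join_r ?fmul_ge0 ?ui_ge0.
Qed.

Lemma ui_mul_disjointr (R : realType) (V : fuAlg R) (x y z : unit_interval V) :
  (x ⊓ y)%MV = 0 -> (ui_mul x z ⊓ y)%MV = 0.
Proof.
move/(congr1 (@ui_val R V)); rewrite ui_valI => xy.
by apply: ui_val_inj; rewrite ui_valI fmul_disjointr ?ui_ge0.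
Qed.

Lemma ui_mul_disjointl (R : realType) (V : fuAlg R) (x y z : unit_interval V) :
  (x ⊓ y)%MV = 0 -> (ui_mul z x ⊓ y)%MV = 0.
Proof.
move/(congr1 (@ui_val R V)); rewrite ui_valI => xy.
by apply: ui_val_inj; rewrite ui_valI fmul_disjointl ?ui_ge0.
Qed.

HB.instance Definition _ (R : realType) (V : fuAlg R) :=
  MVAlgebra_isPMVf.Build (unit_interval V) (@ui_mulA R V)
    (@ui_mulBr R V) (@ui_mulBl R V)
    (@ui_mul_disjointr R V) (@ui_mul_disjointl R V).

Lemma ui_scaleBr (R : realType) (V : fuAlg R) (a : {i01 R})
    (x y : unit_interval V) :
  (ui_scale a (x ⊙ y^*) = ui_scale a x ⊙ (ui_scale a y)^*)%MV.
Proof.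
apply: ui_val_inj; rewrite ui_valB !ui_valZ ui_valB.
by rewrite riesz_scaleU // scaler0 scalerBr.
Qed.

Lemma ui_scaleBl (R : realType) (V : fuAlg R) (a b : {i01 R})
    (x : unit_interval V) :
  ui_scale (Num.max 0 (a%:num - b%:num))%:i01 x =
  (ui_scale a x ⊙ (ui_scale b x)^*)%MV.
Proof.
have scale_ge0 (c : R) : 0 <= c -> 0 <= c *: ui_val x.
  by move=> c0; rewrite -(scaler0 V c) riesz_leZ2l ?ui_ge0.
apply: ui_val_inj; rewrite ui_valB /= -scalerBl.
have [ab|ba] := leP 0 (a%:num - b%:num); first by rewrite riesz_join_r ?scale_ge0.
rewrite scale0r riesz_joinC riesz_join_r //.
by rewrite -riesz_leN2 oppr0 -scaleNr scale_ge0 // oppr_ge0 ltW.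
Qed.

Lemma ui_scaleA (R : realType) (V : fuAlg R) (a b : {i01 R})
    (x : unit_interval V) :
  ui_scale a (ui_scale b x) = ui_scale (a%:num * b%:num)%:i01 x.
Proof. by apply: ui_val_inj; rewrite /= scalerA. Qed.

Lemma ui_scale1 (R : realType) (V : fuAlg R) (x : unit_interval V) :
  ui_scale 1%:i01 x = x.
Proof. by apply: ui_val_inj; rewrite /= scale1r. Qed.

HB.instance Definition _ (R : realType) (V : fuAlg R) :=
  MVAlgebra_isRieszMV.Build R (unit_interval V) (@ui_scaleBr R V)
    (@ui_scaleBl R V) (@ui_scaleA R V) (@ui_scale1 R V).

Lemma ui_scale_mull (R : realType) (V : fuAlg R) (a : {i01 R})
    (x y : unit_interval V) :
  ui_scale a (ui_mul x y) = ui_mul (ui_scale a x) y.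
Proof. by apply: ui_val_inj; rewrite /= fmulZl. Qed.

Lemma ui_scale_mulr (R : realType) (V : fuAlg R) (a : {i01 R})
    (x y : unit_interval V) :
  ui_scale a (ui_mul x y) = ui_mul x (ui_scale a y).
Proof. by apply: ui_val_inj; rewrite /= fmulZr. Qed.

HB.instance Definition _ (R : realType) (V : fuAlg R) :=
  PMVf_RieszMV_isFMV.Build R (unit_interval V)
    (@ui_scale_mull R V) (@ui_scale_mulr R V).

Lemma fu_map0 (R : realType) (V W : fuAlg R) (g : fu_hom V W) : g 0 = 0.
Proof.
by have := fu_map_linear g (-1) 0 0; rewrite !scaleN1r oppr0 addr0 addNr.
Qed.

Lemma fu_mapD (R : realType) (V W : fuAlg R) (g : fu_hom V W) :
  {morph g : x y / x + y}.
Proof. by move=> x y; have := fu_map_linear g 1 x y; rewrite !scale1r. Qed.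

Lemma fu_mapZ (R : realType) (V W : fuAlg R) (g : fu_hom V W) (a : R) :
  {morph g : x / a *: x}.
Proof.
by move=> x; have := fu_map_linear g a x 0; rewrite fu_map0 !addr0.
Qed.

Lemma fu_map_le (R : realType) (V W : fuAlg R) (g : fu_hom V W) :
  {homo g : x y / x <= y}.
Proof. by move=> x y /riesz_meet_l <-; rewrite fu_mapI riesz_leIr. Qed.

Lemma ui_map_subproof (R : realType) (V W : fuAlg R) (g : fu_hom V W)
    (x : unit_interval V) :
  let z := g (ui_val x) in (0 <= z) && (z <= fu_unit W).
Proof.
by rewrite /= -(fu_map0 g) -(fu_map_unit g) !fu_map_le ?ui_ge0 ?ui_le1.
Qed.

Definition ui_map (R : realType) (V W : fuAlg R) (g : fu_hom V W)
  (x : unit_interval V) : unit_interval W :=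
  UnitInterval (ui_map_subproof g x).

Definition Gamma_f_hom (R : realType) (V W : fuAlg R) (g : fu_hom V W) :
  fmv_hom (unit_interval V) (unit_interval W).
Proof.
apply: (@FMVHom R (unit_interval V) (unit_interval W) (ui_map g)).
- move=> x y; apply: ui_val_inj.
  by rewrite /= fu_mapI fu_mapD fu_map_unit.
- by move=> x y; apply: ui_val_inj; rewrite /= fu_mapM.
- move=> x; apply: ui_val_inj.
  by rewrite /= fu_mapD -scaleN1r fu_mapZ scaleN1r fu_map_unit.
- by move=> a x; apply: ui_val_inj; rewrite /= fu_mapZ.
- by apply: ui_val_inj; rewrite /= fu_map0.
Defined.

Definition Gamma_f (R : realType) : functor (fuAlgCat R) (fMV R).
Proof.
apply: (@Functor (fuAlgCat R) (fMV R)
  (fun V : fuAlg R => unit_interval V : fmvAlgType R) (@Gamma_f_hom R)).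
- by move=> V; apply/fmv_hom_ext/funext => x; exact: ui_val_inj.
- by move=> U V W g f; apply/fmv_hom_ext/funext => x; exact: ui_val_inj.
Defined.

(* Main.v *)
(* The inverse of [Gamma_f] sends an fMV-algebra [A] to the space of germs at the
   midpoint of [A]. Multiplication by scalars of [0, 1] makes [A] a convex set
   with centre [1/2], and the homothety of ratio [x] at the centre,
   [a |-> 1/2 + x (a - 1/2)], is expressible in [A] itself. A vector is a pair
   [(r, a)], read as [r (a - 1/2)]; two vectors are compared, added or met after
   shrinking both by a common large factor [N], where no operation of [A]
   truncates. This yields a Riesz space in which [A] is order isomorphic to the
   interval [0, u]. A map that is additive and homogeneous as far as this makes
   sense on [0, u] extends uniquely to a linear map; applied in each variable
   this extends the product of [A] to the Riesz space, and applied to morphisms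
   it shows that [Gamma_f] is full and faithful. *)
From HB Require Import structures.
From mathcomp Require Import all_boot all_order all_algebra.
From mathcomp Require Import interval_inference boolp reals.
From mathcomp Require Import generic_quotient ring lra.
Require Import Defs.

Set Implicit Arguments.
Unset Strict Implicit.
Unset Printing Implicit Defensive.

Import Order.TTheory GRing.Theory Num.Theory.

Local Open Scope ring_scope.
Local Open Scope quotient_scope.
Local Open Scope riesz_scope.

(** * MV-algebras *)

Section MVTheory.
Context {A : mvAlgType}.
Implicit Types x y z c d e : A.

Definition mvone : A := mvneg 0.
(** Truncated subtraction, that is, [x] minus [y] cut off at zero. *)
Definition mvsub x y : A := mvneg (mvneg x + y).
Definition mvle x y : bool := mvneg x + y == mvone.
(** Under orthogonality the sum [x + y] is not truncated; this is the domain of the partial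
    addition, which behaves like addition in a group. *)
Definition mvorth x y : bool := mvle x (mvneg y).

Lemma mvneg1 : mvneg mvone = 0. Proof. exact: mvnegK. Qed.

Lemma mvadd1 x : mvone + x = mvone. Proof. by rewrite addrC mvaddr1. Qed.

Lemma mvsub0 x : mvsub x 0 = x. Proof. by rewrite /mvsub addr0 mvnegK. Qed.

Lemma mvadd_neg x : x + mvneg x = mvone.
Proof.
have := mvlukasiewicz x mvone.
by rewrite mvaddr1 mvneg1 add0r [RHS]addrC => <-.
Qed.

Lemma mvsubxx x : mvsub x x = 0.
Proof. by rewrite /mvsub addrC mvadd_neg mvneg1. Qed.

Lemma mvsub_eq0 x y : (mvsub x y == 0) = mvle x y.
Proof. by rewrite /mvle -(inj_eq (can_inj (@mvnegK A))) mvnegK. Qed.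

Lemma mvsubK x y : mvle y x -> mvsub x y + y = x.
Proof.
rewrite /mvle /mvsub mvlukasiewicz => /eqP->.
by rewrite mvneg1 add0r.
Qed.

Lemma mvle_addr x y : mvle x (x + y).
Proof. by rewrite /mvle addrA (addrC _ x) mvadd_neg mvadd1. Qed.

Lemma mvle_addl x y : mvle x (y + x).
Proof. by rewrite addrC mvle_addr. Qed.

Lemma mvle_refl x : mvle x x.
Proof. by rewrite -{2}[x]addr0 mvle_addr. Qed.

Lemma mvle0 x : mvle 0 x. Proof. by rewrite -[x]add0r mvle_addr. Qed.

Lemma mvle1 x : mvle x mvone. Proof. by rewrite /mvle mvaddr1. Qed.

Lemma mvle_trans y x z : mvle x y -> mvle y z -> mvle x z.
Proof.
by move=> /mvsubK xy /mvsubK <-; rewrite -xy addrA mvle_addl.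
Qed.

Lemma mvle_anti x y : mvle x y -> mvle y x -> x = y.
Proof.
move=> xy /mvsubK yx; move: xy; rewrite -mvsub_eq0 => /eqP xy.
by rewrite -yx xy add0r.
Qed.

Lemma mvle_add x y z t : mvle x y -> mvle z t -> mvle (x + z) (y + t).
Proof.
by move=> /mvsubK<- /mvsubK<-; rewrite addrACA mvle_addl.
Qed.

Lemma mvle_neg x y : mvle (mvneg x) (mvneg y) = mvle y x.
Proof. by rewrite /mvle mvnegK addrC. Qed.

Lemma mvle_sub_add x y z : mvle (mvsub x y) z = mvle x (y + z).
Proof. by rewrite /mvle mvnegK addrA. Qed.

Lemma mvsub_le x y : mvle (mvsub x y) x.
Proof. by rewrite mvle_sub_add mvle_addl. Qed.

Lemma mvle_sub x y z t : mvle x y -> mvle t z -> mvle (mvsub x z) (mvsub y t).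
Proof. by move=> xy tz; rewrite mvle_neg mvle_add // mvle_neg. Qed.

Lemma mvsub_sub x y z : mvsub (mvsub x y) z = mvsub x (y + z).
Proof. by rewrite /mvsub mvnegK addrA. Qed.

Lemma mvsub1 x : mvsub mvone x = mvneg x.
Proof. by rewrite /mvsub mvneg1 add0r. Qed.

Lemma mvorthC x y : mvorth x y = mvorth y x.
Proof. by rewrite /mvorth /mvle addrC. Qed.

Lemma mvorth_le x y z t :
  mvle x z -> mvle y t -> mvorth z t -> mvorth x y.
Proof.
move=> xz yt zt; apply: mvle_trans xz _; apply: mvle_trans zt _.
by rewrite mvle_neg.
Qed.

(** The Łukasiewicz identity trades the inner difference for [mvsub y (mvneg x)], which
    orthogonality makes zero. *)
Lemma mvaddK x y : mvorth x y -> mvsub (x + y) y = x.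
Proof.
move=> xy; rewrite /mvsub -{1}[x]mvnegK mvlukasiewicz -/(mvsub y (mvneg x)).
move: xy; rewrite mvorthC /mvorth -mvsub_eq0 => /eqP->.
by rewrite add0r mvnegK.
Qed.

Lemma mvorth_sub x y : mvle y x -> mvorth y (mvsub x y).
Proof. by move=> yx; rewrite /mvorth mvnegK mvle_addl. Qed.

(** Since [d] lies below [mvneg e], that element splits as [mvsub (mvneg e) d + d], and [c] lies
    below the first summand. With this the partial addition is associative together with its
    domain. *)
Lemma mvorthA c d e : mvorth d e -> mvorth c (d + e) -> mvorth (c + d) e.
Proof.
move=> de cde.
have -> : c + d = c + mvneg (mvneg d) by rewrite mvnegK.
rewrite /mvorth.
apply: (@mvle_trans (mvsub (mvneg e) d + d)).
  by rewrite mvnegK mvle_add ?mvle_refl // /mvsub mvnegK addrC.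
by rewrite mvsubK ?mvle_refl.
Qed.

Lemma mvaddKl c d e : mvorth c d -> mvle e c -> mvsub (c + d) e = mvsub c e + d.
Proof.
move=> cd ec; have ce := mvsubK ec; set c' := mvsub c e in ce *.
rewrite -{1}ce addrAC mvaddK // addrC mvorthA //.
  by rewrite mvorthC mvorth_sub.
by rewrite ce mvorthC.
Qed.

Lemma mvle_add2r x y z : mvorth x z -> mvle (x + z) (y + z) -> mvle x y.
Proof.
move=> xz; rewrite -{2}(mvaddK xz) => h.
apply: (mvle_trans (mvle_sub h (mvle_refl z))).
by rewrite mvle_sub_add addrC mvle_refl.
Qed.

Lemma mvmeetE x y : mvmeet x y = mvsub x (mvsub x y).
Proof. by []. Qed.

Lemma mvmulE x y : mvmul x (mvneg y) = mvsub x y.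
Proof. by rewrite /mvmul mvnegK. Qed.

(** De Morgan dual of the Łukasiewicz identity, which is commutativity of the join. *)
Lemma mvmeetC x y : mvmeet x y = mvmeet y x.
Proof.
rewrite !mvmeetE /mvsub.
have e u v : mvneg u + mvneg (mvneg u + v) =
    mvneg (mvneg (mvneg v) + mvneg u) + mvneg u.
  by rewrite mvnegK addrC [v + _]addrC.
by rewrite !e mvlukasiewicz.
Qed.

Lemma mvmeet_l x y : mvle x y -> mvmeet x y = x.
Proof. by rewrite -mvsub_eq0 mvmeetE => /eqP ->; rewrite mvsub0. Qed.

Lemma mvle_meetl x y : mvle (mvmeet x y) x.
Proof. exact: mvsub_le. Qed.

Lemma mvle_meetr x y : mvle (mvmeet x y) y.
Proof. by rewrite mvmeetC mvle_meetl. Qed.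

Lemma mvle_meet z x y : mvle z (mvmeet x y) = mvle z x && mvle z y.
Proof.
apply/idP/andP => [h|[zx zy]].
  by split; apply: mvle_trans h _; rewrite ?mvle_meetl ?mvle_meetr.
rewrite -(mvmeet_l zx) mvmeetC !mvmeetE.
by apply: mvle_sub; rewrite ?mvle_refl // mvle_sub ?mvle_refl.
Qed.

Lemma mvmeetD x y z : mvorth x z -> mvorth y z ->
  mvmeet (x + z) (y + z) = mvmeet x y + z.
Proof.
move=> xz yz; rewrite !mvmeetE (addrC y) -mvsub_sub mvaddK //.
by rewrite mvaddKl ?mvsub_le.
Qed.

Lemma mvsub_addl x y : mvsub (x + y) x = mvmeet y (mvneg x).
Proof.
have := mvlukasiewicz (mvneg y) x; rewrite mvnegK => h.
by rewrite mvmeetE /mvsub (addrC x) h addrC (addrC (mvneg x)).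
Qed.

End MVTheory.

(** * Scalars and homotheties in Riesz MV-algebras *)

Lemma clamp_ge0 (R : realType) (x : R) : 0 <= Num.max 0 (Num.min 1 x).
Proof. by rewrite le_max lexx. Qed.

Lemma clamp_le1 (R : realType) (x : R) : Num.max 0 (Num.min 1 x) <= 1.
Proof. by rewrite ge_max ler01 ge_min lexx. Qed.

(** Reals are truncated to the unit interval so that scalars can be computed in [R], with range
    conditions needed only where they matter. *)
Definition clamp (R : realType) (x : R) : {i01 R} :=
  Itv01 (clamp_ge0 x) (clamp_le1 x).

Lemma clampE (R : realType) (x : R) : 0 <= x -> x <= 1 -> (clamp x)%:num = x.
Proof. by move=> x0 x1; rewrite /= min_r // max_r. Qed.

Lemma clamp_num (R : realType) (a : {i01 R}) : clamp a%:num = a.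
Proof. by apply: val_inj; apply: clampE. Qed.

Section RieszMVTheory.
Context {R : realType} {A : rieszMVAlgType R}.
Implicit Types (a b c d : A) (x y p q : R).

Definition sc x a : A := mvscale (clamp x) a.

Lemma sc_sub x a b : sc x (mvsub a b) = mvsub (sc x a) (sc x b).
Proof. by rewrite -!mvmulE /sc mvscaleBr. Qed.

Lemma sc_subl x y a : 0 <= y -> y <= x -> x <= 1 ->
  sc (x - y) a = mvsub (sc x a) (sc y a).
Proof.
move=> y0 yx x1; rewrite -mvmulE /sc -mvscaleBl; congr mvscale.
have [x0 y1] : 0 <= x /\ y <= 1 by split; lra.
have [xy0 xy1] : 0 <= x - y /\ x - y <= 1 by split; lra.
by apply: val_inj; rewrite /= !min_r // !max_r.
Qed.

Lemma sc0l a : sc 0 a = 0.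
Proof. by rewrite -[X in sc X](subrr 0) sc_subl ?lexx ?ler01 ?mvsubxx. Qed.

Lemma sc0r x : sc x (0 : A) = 0.
Proof. by rewrite -(mvsubxx 0) sc_sub !mvsubxx. Qed.

Lemma sc1l a : sc 1 a = a.
Proof.
by rewrite /sc -[RHS](mvscale1 a); congr mvscale; apply: val_inj => /=;
  rewrite min_r ?max_r.
Qed.

Lemma scA x y a : 0 <= x <= 1 -> 0 <= y <= 1 -> sc x (sc y a) = sc (x * y) a.
Proof.
move=> /andP[x0 x1] /andP[y0 y1]; rewrite /sc mvscaleA; congr mvscale.
apply: val_inj; rewrite [RHS]clampE ?mulr_ge0 ?mulr_ile1 //.
by rewrite /= !min_r ?max_r.
Qed.

Lemma sc_le x a b : mvle a b -> mvle (sc x a) (sc x b).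
Proof. by rewrite -!mvsub_eq0 -sc_sub => /eqP ->; rewrite sc0r. Qed.

Lemma sc_lel x y a : 0 <= y -> y <= x -> x <= 1 -> mvle (sc y a) (sc x a).
Proof.
move=> y0 yx x1; rewrite -mvsub_eq0 -mvmulE /sc -mvscaleBl.
have xy : y - x <= 0 by lra.
rewrite -[X in _ == X](sc0l a) /sc; apply/eqP; congr mvscale.
have [x0 y1] : 0 <= x /\ y <= 1 by split; lra.
apply: val_inj; rewrite /= (min_r x1) (min_r y1) (max_r x0) (max_r y0).
by rewrite max_l // min_r // max_r.
Qed.

Lemma scDl x y a : 0 <= x -> 0 <= y -> x + y <= 1 ->
  sc (x + y) a = sc x a + sc y a.
Proof.
move=> x0 y0 xy1; have -> : sc x a = mvsub (sc (x + y) a) (sc y a).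
  by rewrite -sc_subl ?addrK //; lra.
by rewrite mvsubK // sc_lel //; lra.
Qed.

Lemma scDr x a b : mvorth a b -> sc x (a + b) = sc x a + sc x b.
Proof.
move=> ab; have -> : sc x a = mvsub (sc x (a + b)) (sc x b).
  by rewrite -sc_sub mvaddK.
by rewrite mvsubK // sc_le // mvle_addl.
Qed.

(** A size bound by a multiple of the unit: elements whose weights add up to at most 1 are
    orthogonal. *)
Definition weight_le x a := mvle a (sc x mvone).

Lemma weight_sc x a : weight_le x (sc x a).
Proof. by rewrite /weight_le sc_le // mvle1. Qed.

Lemma weightD x y a b : 0 <= x -> 0 <= y -> x + y <= 1 ->
  weight_le x a -> weight_le y b -> weight_le (x + y) (a + b).
Proof.
by move=> x0 y0 xy ax bc; rewrite /weight_le scDl // mvle_add.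
Qed.

Lemma weight_orth x y a b : 0 <= x -> 0 <= y -> x + y <= 1 ->
  weight_le x a -> weight_le y b -> mvorth a b.
Proof.
move=> x0 y0 xy ax bc; apply: mvorth_le ax bc _.
rewrite /mvorth -mvsub1 -{2}[mvone]sc1l -sc_subl //; last by lra.
by apply: sc_lel; lra.
Qed.

Lemma sc_orth x y a b : 0 <= x -> 0 <= y -> x + y <= 1 ->
  mvorth (sc x a) (sc y b).
Proof. by move=> x0 y0 xy; apply: (weight_orth x0 y0 xy); exact: weight_sc. Qed.

Lemma mvorth_neg a : mvorth a (mvneg a).
Proof. by rewrite /mvorth mvnegK mvle_refl. Qed.

Lemma sc_addneg x a : sc x a + sc x (mvneg a) = sc x mvone.
Proof. by rewrite -scDr ?mvadd_neg // mvorth_neg. Qed.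

Lemma sc_neg x a : sc x (mvneg a) = mvsub (sc x mvone) (sc x a).
Proof. by rewrite -sc_sub mvsub1. Qed.

(** Negation is affine: the unit is [p] times itself plus [q] times itself, and each term is
    subtracted from its own share. *)
Lemma conv_neg p q a b : 0 <= p -> 0 <= q -> p + q = 1 ->
  mvneg (sc p a + sc q b) = sc p (mvneg a) + sc q (mvneg b).
Proof.
move=> p0 q0 pq; have pq1 : p + q <= 1 by rewrite pq.
rewrite -mvsub1 -mvsub_sub -{1}[mvone]sc1l -pq scDl //.
rewrite mvaddKl ?sc_orth // ?sc_le ?mvle1 // -sc_neg.
rewrite addrC mvaddKl ?sc_le ?mvle1 // -?sc_neg 1?addrC //.
by rewrite sc_orth // addrC.
Qed.

(** Some [1/(n+1)] lies below [x] and hence annihilates [a]; adding up [n+1] such pieces recovers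
    [a]. *)
Lemma sc_eq0 x a : 0 < x -> sc x a = 0 -> a = 0.
Proof.
wlog x1 : x / x <= 1 => [hw x0|x0 ax].
  have [x1|x1] := leP x 1; first exact: hw.
  (* Above 1 the scalar is clamped to 1, so this case is immediate. *)
  suff -> : sc x a = sc 1 a by rewrite sc1l.
  by rewrite /sc; congr mvscale; apply: val_inj; rewrite /= min_l ?ltW // minxx.
have [n nx] : exists n : nat, x^-1 <= n.+1%:R.
  by exists (Num.truncn x^-1); apply/ltW; exact: truncnS_gt.
have n0 : 0 < n.+1%:R :> R by [].
have nV : n.+1%:R^-1 <= x by rewrite invf_ple.
have ik (k : nat) : (k <= n.+1)%N -> sc (k%:R / n.+1%:R) a = 0.
  elim: k => [|k ih] kn; first by rewrite mul0r sc0l.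
  rewrite -natr1 mulrDl mul1r scDl ?divr_ge0 ?invr_ge0 //; last first.
    by rewrite -[X in _ + X]mul1r -mulrDl natr1 ler_pdivrMr // mul1r ler_nat.
  rewrite ih ?(ltnW kn) // add0r; apply: mvle_anti; last exact: mvle0.
  by rewrite -ax; apply: sc_lel => //; rewrite invr_ge0.
by have := ik n.+1 (leqnn _); rewrite divff // ?sc1l // gt_eqF.
Qed.

Lemma sc_inj_le x a b : 0 < x -> mvle (sc x a) (sc x b) -> mvle a b.
Proof.
by move=> x0; rewrite -!mvsub_eq0 -sc_sub => /eqP /(sc_eq0 x0) ->.
Qed.

Lemma sc_meet x a b : sc x (mvmeet a b) = mvmeet (sc x a) (sc x b).
Proof. by rewrite !mvmeetE !sc_sub. Qed.

(* In the vector space to be built, [contr x a] is [1/2 + x (a - 1/2)]. *)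
Definition contr x a : A := sc ((1 + x) / 2) a + sc ((1 - x) / 2) (mvneg a).

Lemma contr_orth x a : `|x| <= 1 ->
  mvorth (sc ((1 + x) / 2) a) (sc ((1 - x) / 2) (mvneg a)).
Proof. by rewrite ler_norml => /andP[x0 x1]; apply: sc_orth; lra. Qed.

Lemma contr0 a : contr 0 a = sc 2^-1 mvone.
Proof. by rewrite /contr addr0 subr0 !mul1r sc_addneg. Qed.

Lemma contrN x a : contr (- x) a = contr x (mvneg a).
Proof. by rewrite /contr opprK mvnegK addrC. Qed.

Lemma contr_neg x a : `|x| <= 1 -> mvneg (contr x a) = contr x (mvneg a).
Proof.
rewrite ler_norml => /andP[x0 x1].
by rewrite /contr conv_neg ?mvnegK //; lra.
Qed.

(** A share [(1 - x) / 2] of [a] combines with the complement into a multiple of the unit. What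
    remains is visibly monotone in [a], hence the compatibility with order and meet below. *)
Lemma contr_ge0 x a : 0 <= x -> x <= 1 ->
  contr x a = sc x a + sc ((1 - x) / 2) mvone.
Proof.
move=> x0 x1; rewrite /contr -(sc_addneg _ a) addrA -scDl; [|lra..].
by congr (sc _ _ + _); lra.
Qed.

(** Homotheties with a common centre compose by multiplying ratios: expand, then collect the
    coefficients of [a] and of its complement. *)
Lemma contrA x y a : `|x| <= 1 -> `|y| <= 1 ->
  contr x (contr y a) = contr (x * y) a.
Proof.
move=> hx hy; have xy : `|x * y| <= 1 by rewrite normrM mulr_ile1.
rewrite {1}/contr contr_neg // {1 2}/contr mvnegK.
rewrite scDr ?contr_orth // [sc _ (sc _ (mvneg a) + _)]scDr; last first.
  by rewrite -{2}[a]mvnegK contr_orth.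
move: hx hy xy; rewrite !ler_norml => /andP[x0 x1] /andP[y0 y1] /andP[xy0 xy1].
rewrite !scA; [|apply/andP; split; lra..].
rewrite [sc _ (mvneg a) + sc _ a]addrC addrACA -!scDl.
- by rewrite /contr; congr (sc _ _ + sc _ _); field.
all: try by apply: mulr_ge0; lra.
- have -> : (1 + x) / 2 * ((1 - y) / 2) + (1 - x) / 2 * ((1 + y) / 2) = (1 - x * y) / 2 by field.
  lra.
- have -> : (1 + x) / 2 * ((1 + y) / 2) + (1 - x) / 2 * ((1 - y) / 2) = (1 + x * y) / 2 by field.
  lra.
Qed.

(** The midpoint, a total substitute for addition: halving first means that nothing is truncated. *)
Definition mid a b : A := sc 2^-1 a + sc 2^-1 b.

Lemma half_orth a b : mvorth (sc 2^-1 a) (sc 2^-1 b).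
Proof. by apply: sc_orth; lra. Qed.

Lemma contr_midl x y a : `|x| <= 1 -> `|y| <= 1 ->
  contr ((x + y) / 2) a = mid (contr x a) (contr y a).
Proof.
move=> hx hy; rewrite /mid !scDr ?contr_orth //.
move: hx hy; rewrite !ler_norml => /andP[x0 x1] /andP[y0 y1].
rewrite !scA; [|apply/andP; split; lra..].
rewrite addrACA -!scDl; [|lra..].
by rewrite /contr; congr (sc _ _ + sc _ _); field.
Qed.

Lemma contr_midr x a b : `|x| <= 1 ->
  contr x (mid a b) = mid (contr x a) (contr x b).
Proof.
move=> hx; rewrite /mid [sc _ (contr x a)]scDr ?contr_orth //.
rewrite [sc _ (contr x b)]scDr ?contr_orth // {1}/contr conv_neg; [|lra..].
move: hx; rewrite !ler_norml => /andP[x0 x1].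
rewrite !scDr ?half_orth // !scA; [|apply/andP; split; lra..].
by rewrite addrACA ![2^-1 * _]mulrC.
Qed.

Lemma midC a b : mid a b = mid b a. Proof. exact: addrC. Qed.

(** The medial law; it takes the place of associativity, which midpoints do not satisfy. *)
Lemma midA a b c d : mid (mid a b) (mid c d) = mid (mid a c) (mid b d).
Proof.
rewrite /mid ![sc _ (_ + _)]scDr ?half_orth //.
by rewrite addrACA.
Qed.

Lemma mid_le a b c d : mvle a c -> mvle b d -> mvle (mid a b) (mid c d).
Proof. by move=> ac bd; rewrite mvle_add // sc_le. Qed.

Lemma contr_le x a b : 0 <= x -> x <= 1 -> mvle a b ->
  mvle (contr x a) (contr x b).
Proof. by move=> x0 x1 ab; rewrite !contr_ge0 // mvle_add ?mvle_refl // sc_le. Qed.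

Lemma contr_meet x a b : 0 <= x -> x <= 1 ->
  contr x (mvmeet a b) = mvmeet (contr x a) (contr x b).
Proof.
move=> x0 x1; rewrite !contr_ge0 // mvmeetD ?sc_meet //; apply: sc_orth; lra.
Qed.

End RieszMVTheory.

(** * The Riesz space enveloping a Riesz MV-algebra *)

Section Eventually.
Context {R : realType}.
Implicit Types (P Q : R -> Prop).

Definition evt P := exists2 N, 0 < N & forall M, N <= M -> P M.

Lemma evt_imp P Q : (forall N, P N -> Q N) -> evt P -> evt Q.
Proof. by move=> PQ [N N0 NP]; exists N => // M /NP /PQ. Qed.

Lemma evtI P Q : evt P -> evt Q -> evt (fun N => P N /\ Q N).
Proof.
move=> [N N0 NP] [M M0 MQ]; exists (N + M); first exact: addr_gt0.
by move=> K NMK; split; [apply: NP|apply: MQ]; lra.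
Qed.

Lemma evtT P : (forall N, P N) -> evt P.
Proof. by exists 1. Qed.

Lemma evt_div P c : 0 < c -> evt P -> evt (fun N => P (N / c)).
Proof.
move=> c0 [N N0 NP]; exists (N * c); first exact: mulr_gt0.
by move=> M NM; apply: NP; rewrite ler_pdivlMr.
Qed.

Lemma evt_ge N : evt (fun M => N <= M).
Proof.
exists (1 + `|N|); first by rewrite ltr_pwDl.
by move=> M; apply: le_trans; rewrite ler_wpDl // ler_norm.
Qed.

Lemma evt_norm (r : R) : evt (fun N => `|r / N| <= 1).
Proof.
have := evtI (evt_ge 1) (evt_ge `|r|); apply: evt_imp => N [N1 rN].
have N0 : 0 < N by lra.
by rewrite normrM normfV (gtr0_norm N0) ler_pdivrMr // mul1r.
Qed.

End Eventually.

(** * Formal vectors and their levels *)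

Section Germs.
Context {R : realType} {A : rieszMVAlgType R}.
Implicit Types (p q t : R * A) (N : R).

(* The pair [(r, a)] stands for the vector [r (a - 1/2)]. Its level [N], for
   [N >= |r|], is the element [1/2 + (r / N) (a - 1/2)] of [A]. *)
Definition lvl N p : A := contr (p.1 / N) p.2.

(** [N] exceeds both coefficients, so both levels are genuine homotheties. The midpoint is half of
    the sum at that level, whence the coefficient [2 * N]. *)
Definition gadd p q : R * A :=
  let N := `|p.1| + `|q.1| + 1 in (2 * N, mid (lvl N p) (lvl N q)).

Definition gscale (l : R) p : R * A := (l * p.1, p.2).

Definition gmeet p q : R * A :=
  let N := `|p.1| + `|q.1| + 1 in (N, mvmeet (lvl N p) (lvl N q)).

(** The centre of [A], which is the zero vector at every level. *)
Definition ghalf : A := sc 2^-1 mvone.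

(** By composition of homotheties, one level beyond the coefficient determines all higher ones. *)
Lemma lvl_ratio M N p : 0 < M -> M <= N -> `|p.1| <= M ->
  lvl N p = contr (M / N) (lvl M p).
Proof.
move=> M0 MN pM; have N0 := lt_le_trans M0 MN.
rewrite /lvl contrA.
- by congr contr; field; rewrite ?gt_eqF.
- by rewrite ger0_norm ?ler_pdivrMr ?mul1r // divr_ge0 // ltW.
- by rewrite normrM normfV (gtr0_norm M0) ler_pdivrMr // mul1r.
Qed.

Lemma lvl_gadd p q :
  evt (fun N => lvl N (gadd p q) = mid (lvl (N / 2) p) (lvl (N / 2) q)).
Proof.
set N0 := `|p.1| + `|q.1| + 1.
have p0 := normr_ge0 p.1; have q0 := normr_ge0 q.1.
have := evt_ge (2 * N0); apply: evt_imp => N NN.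
have N00 : 0 < N0 by rewrite /N0; lra.
have h : 2 * N0 / N = N0 / (N / 2) by field; apply: lt0r_neq0; lra.
rewrite [LHS]/lvl /= h contr_midr; last first.
  rewrite ger0_norm ?ler_pdivrMr ?mul1r ?divr_ge0 ?divr_gt0 //; lra.
rewrite -!lvl_ratio //; try by [lra | rewrite /N0; lra].
Qed.

(** Doubling the level halves the vector, which is the same as taking the midpoint with the centre.
    It brings summands of unequal depth to a common level. *)
Lemma lvl_half p : evt (fun N => lvl N p = mid (lvl (N / 2) p) ghalf).
Proof.
have := evtI (evt_div (c := 2) ltac:(lra) (evt_norm p.1)) (evt_ge 1).
apply: evt_imp => N [pN N1].
rewrite /ghalf -(contr0 p.2) /lvl -contr_midl ?normr0 //.
by congr contr; field; apply: lt0r_neq0; lra.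
Qed.

(** Dividing by [1 + |l|] keeps the ratio of the homothety in [[-1, 1]] whatever [l] is; the level
    is lowered by the same factor to compensate. *)
Lemma lvl_gscale l p :
  evt (fun N => lvl N (gscale l p) =
    contr (l / (1 + `|l|)) (lvl (N / (1 + `|l|)) p)).
Proof.
set m := 1 + `|l|; have m0 : 0 < m by rewrite ltr_pwDl.
have := evtI (evt_div m0 (evt_norm p.1)) (evt_ge 1).
apply: evt_imp => N [pN N1].
rewrite /lvl contrA //=.
  by congr contr; field; rewrite !lt0r_neq0 //; lra.
by rewrite normrM normfV (gtr0_norm m0) ler_pdivrMr // mul1r lerDr.
Qed.

Lemma lvl_gmeet p q :
  evt (fun N => lvl N (gmeet p q) = mvmeet (lvl N p) (lvl N q)).
Proof.
set N0 := `|p.1| + `|q.1| + 1.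
have p0 := normr_ge0 p.1; have q0 := normr_ge0 q.1.
have := evt_ge N0; apply: evt_imp => N NN.
have N00 : 0 < N0 by rewrite /N0; lra.
rewrite [LHS]/lvl /= contr_meet -?lvl_ratio //; try by [lra|rewrite /N0; lra].
  by rewrite divr_ge0 //; lra.
by rewrite ler_pdivrMr ?mul1r //; lra.
Qed.

Definition geqv p q : bool := `[< evt (fun N => lvl N p = lvl N q) >].

Lemma geqv_equiv : equiv_class_of geqv.
Proof.
split=> [p|p q|q p t].
- by apply/asboolP/evtT.
- by apply/asboolP/asboolP; apply: evt_imp.
- move=> /asboolP pq /asboolP qt; apply/asboolP.
  by have := evtI pq qt; apply: evt_imp => N [-> ->].
Qed.

Canonical geqv_rel := EquivRelPack geqv_equiv.

End Germs.

(** * The quotient by eventual equality of levels, as a Riesz space *)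

Definition envelope (R : realType) (A : rieszMVAlgType R) : Type :=
  {eq_quot @geqv_rel R A}.

Section Envelope.
Context {R : realType} {A : rieszMVAlgType R}.
Local Notation V := (envelope A).
Implicit Types (p q t : R * A) (u v w : V) (a b : A).

HB.instance Definition _ := Choice.copy V {eq_quot @geqv_rel R A}.

Definition cls p : V := \pi_({eq_quot @geqv_rel R A}) p.
Definition rp u : R * A := repr (u : {eq_quot @geqv_rel R A}).

Lemma clsP p q : (cls p = cls q) <-> evt (fun N => lvl N p = lvl N q).
Proof. by split=> [/eqmodP/asboolP|h]; last by apply/eqmodP/asboolP. Qed.

Lemma rpK u : cls (rp u) = u. Proof. exact: reprK. Qed.

Lemma cls_rp p : evt (fun N => lvl N (rp (cls p)) = lvl N p).
Proof. by apply/clsP; exact: rpK. Qed.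

Lemma clsW (P : V -> Prop) : (forall p, P (cls p)) -> forall u, P u.
Proof. by move=> h u; rewrite -(rpK u). Qed.

Definition vadd u v : V := cls (gadd (rp u) (rp v)).
Definition vscale (l : R) u : V := cls (gscale l (rp u)).
Definition vmeet u v : V := cls (gmeet (rp u) (rp v)).
Definition vle u v : bool :=
  `[< evt (fun N => mvle (lvl N (rp u)) (lvl N (rp v))) >].

Lemma vaddE p q : vadd (cls p) (cls q) = cls (gadd p q).
Proof.
apply/clsP; have := evtI (evtI (lvl_gadd p q) (lvl_gadd (rp (cls p)) (rp (cls q))))
  (evt_div (c := 2) ltac:(lra) (evtI (cls_rp p) (cls_rp q))).
by apply: evt_imp => N [[-> ->] [-> ->]].
Qed.

Lemma vscaleE l p : vscale l (cls p) = cls (gscale l p).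
Proof.
have l0 : 0 < 1 + `|l| by rewrite ltr_pwDl.
apply/clsP; have := evtI (evtI (lvl_gscale l p) (lvl_gscale l (rp (cls p))))
  (evt_div l0 (cls_rp p)).
by apply: evt_imp => N [[-> ->] ->].
Qed.

Lemma vmeetE p q : vmeet (cls p) (cls q) = cls (gmeet p q).
Proof.
apply/clsP; have := evtI (evtI (lvl_gmeet p q) (lvl_gmeet (rp (cls p)) (rp (cls q))))
  (evtI (cls_rp p) (cls_rp q)).
by apply: evt_imp => N [[-> ->] [-> ->]].
Qed.

Lemma vleP p q :
  reflect (evt (fun N => mvle (lvl N p) (lvl N q))) (vle (cls p) (cls q)).
Proof.
apply: (iffP (asboolP _)) => h; have := evtI h (evtI (cls_rp p) (cls_rp q));
  apply: evt_imp => N [hN [ep eq]].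
- by rewrite -ep -eq.
- by rewrite ep eq.
Qed.

Definition vzero : V := cls (0, 0).

Lemma lvl_zero N : lvl N ((0, 0) : R * A) = ghalf.
Proof. by rewrite /lvl mul0r contr0. Qed.

Lemma vaddC : commutative vadd.
Proof.
elim/clsW => p; elim/clsW => q; rewrite !vaddE; apply/clsP.
by have := evtI (lvl_gadd p q) (lvl_gadd q p);
  apply: evt_imp => N [-> ->]; rewrite midC.
Qed.

Lemma vaddA : associative vadd.
Proof.
elim/clsW => p; elim/clsW => q; elim/clsW => t; rewrite !vaddE; apply/clsP.
have two : 0 < 2 :> R by lra.
have := evtI (evtI (lvl_gadd p (gadd q t)) (lvl_gadd (gadd p q) t))
  (evt_div two (evtI (evtI (lvl_gadd q t) (lvl_gadd p q))
    (evtI (lvl_half p) (lvl_half t)))).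
(* The outer summands [p] and [t] are brought down to the depth of the nested ones as midpoints with
   the centre; the medial law then regroups. *)
by apply: evt_imp => N [[-> ->] [[-> ->] [-> ->]]];
  rewrite midA (midC ghalf).
Qed.

Lemma vadd0 : left_id vzero vadd.
Proof.
elim/clsW => p; rewrite !vaddE; apply/clsP.
by have := evtI (lvl_gadd (0, 0) p) (lvl_half p); apply: evt_imp => N [-> ->];
  rewrite lvl_zero midC.
Qed.

Lemma vaddN : left_inverse vzero (vscale (-1)) vadd.
Proof.
elim/clsW => p; rewrite vscaleE !vaddE; apply/clsP.
have := evtI (lvl_gadd (gscale (-1) p) p)
  (evt_div (c := 2) ltac:(lra) (evt_norm p.1)).
apply: evt_imp => N [-> pN]; rewrite lvl_zero /lvl /= !mulNr mul1r.
rewrite -contr_midl ?normrN // [- _ + _]addNr mul0r contr0 //.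
Qed.

HB.instance Definition _ := GRing.isZmodule.Build V vaddA vaddC vadd0 vaddN.

Lemma vscaleA (l m : R) v : vscale l (vscale m v) = vscale (l * m) v.
Proof.
elim/clsW: v => p; rewrite !vscaleE; congr cls.
by rewrite /gscale /= mulrA.
Qed.

Lemma vscale1 : left_id 1 vscale.
Proof. by elim/clsW => p; rewrite vscaleE /gscale mul1r; case: p. Qed.

Lemma vscaleDr : right_distributive vscale +%R.
Proof.
move=> l; elim/clsW => p; elim/clsW => q.
rewrite [cls p + _]vaddE !vscaleE [RHS]vaddE; apply/clsP.
have two : 0 < 2 :> R by lra.
have l0 : 0 < 1 + `|l| by rewrite ltr_pwDl.
have l1 : `|l / (1 + `|l|)| <= 1.
  by rewrite normrM normfV (gtr0_norm l0) ler_pdivrMr // mul1r lerDr.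
have := evtI (evtI (lvl_gscale l (gadd p q))
   (lvl_gadd (gscale l p) (gscale l q)))
  (evtI (evt_div l0 (lvl_gadd p q))
    (evt_div two (evtI (lvl_gscale l p) (lvl_gscale l q)))).
apply: evt_imp => N [[-> ->] [-> [-> ->]]].
by rewrite contr_midr // ![_ / 2 / _]mulrAC.
Qed.

Lemma vscaleDl v : {morph vscale^~ v : l m / l + m}.
Proof.
elim/clsW: v => p l m; rewrite !vscaleE [RHS]vaddE; apply/clsP.
have two : 0 < 2 :> R by lra.
have := evtI (evtI (lvl_gadd (gscale l p) (gscale m p)) (evt_ge 1))
  (evt_div two (evtI (evt_norm (l * p.1)) (evt_norm (m * p.1)))).
apply: evt_imp => N [[-> N1] [lN mN]].
rewrite /lvl /= -contr_midl //; congr contr; field.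
by apply: lt0r_neq0; lra.
Qed.

HB.instance Definition _ :=
  GRing.Zmodule_isLmodule.Build R V vscaleA vscale1 vscaleDr vscaleDl.

Lemma vle_refl : reflexive vle.
Proof. by elim/clsW => p; apply/vleP/evtT => N; exact: mvle_refl. Qed.

Lemma vle_anti : antisymmetric vle.
Proof.
elim/clsW => p; elim/clsW => q /andP[/vleP pq /vleP qp]; apply/clsP.
by have := evtI pq qp; apply: evt_imp => N []; exact: mvle_anti.
Qed.

Lemma vle_trans : transitive vle.
Proof.
elim/clsW => p; elim/clsW => q; elim/clsW => t /vleP pq /vleP qp; apply/vleP.
by have := evtI pq qp; apply: evt_imp => N []; exact: mvle_trans.
Qed.

HB.instance Definition _ :=
  Order.Le_isPOrder.Build ring_display V vle_refl vle_anti vle_trans.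

Lemma vlexI v w u : (u <= vmeet v w) = (u <= v) && (u <= w).
Proof.
elim/clsW: u => p; elim/clsW: v => q; elim/clsW: w => t; rewrite vmeetE.
apply/idP/andP => [/vleP h|[/vleP h /vleP h']].
  by split; apply/vleP; have := evtI h (lvl_gmeet q t);
    apply: evt_imp => N [+ e]; rewrite e mvle_meet => /andP[].
by apply/vleP; have := evtI (lvl_gmeet q t) (evtI h h');
    apply: evt_imp => N [-> [? ?]]; rewrite mvle_meet; apply/andP.
Qed.

Lemma vleD2l v w u : v <= w -> u + v <= u + w.
Proof.
elim/clsW: u => p; elim/clsW: v => q; elim/clsW: w => t /vleP qt.
rewrite ![cls p + _]vaddE; apply/vleP.
have := evtI (evtI (lvl_gadd p q) (lvl_gadd p t))
  (evt_div (c := 2) ltac:(lra) qt).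
by apply: evt_imp => N [[-> ->] h]; rewrite mid_le // mvle_refl.
Qed.

Lemma vleZ2l (l : R) u v : 0 <= l -> u <= v -> l *: u <= l *: v.
Proof.
elim/clsW: u => p; elim/clsW: v => q l0 /vleP pq.
have m0 : 0 < 1 + `|l| by rewrite ltr_pwDl.
rewrite ![l *: _]vscaleE; apply/vleP.
have := evtI (evtI (lvl_gscale l p) (lvl_gscale l q)) (evt_div m0 pq).
apply: evt_imp => N [[-> ->] h]; apply: contr_le => //.
  by rewrite divr_ge0 // ltW.
by rewrite ler_pdivrMr // mul1r (le_trans (ler_norm l)) // lerDr.
Qed.

Definition vjoin u v : V := - vmeet (- u) (- v).

Lemma vleN2 u v : (- u <= - v) = (v <= u).
Proof.
have h x y : x <= y -> - y <= - x :> V.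
  by move/(@vleD2l _ _ (- x - y)); rewrite addrAC addNr add0r subrK.
by apply/idP/idP => /h; rewrite ?opprK.
Qed.

Lemma vleUx u v w : (vjoin u v <= w) = (u <= w) && (v <= w).
Proof. by rewrite /vjoin -[w]opprK vleN2 vlexI !vleN2 opprK. Qed.

HB.instance Definition _ := POrderedLmodule_isRieszSpace.Build R V
  vlexI vleUx vleD2l vleZ2l.

End Envelope.

(** * The embedding as a unit interval *)

Section Embedding.
Context {R : realType} {A : rieszMVAlgType R}.
Local Notation V := (envelope A).
Implicit Types (p q : R * A) (u v w : V) (a b : A).

Lemma nat_bound (x : R) : exists n : nat, x <= n.+1%:R.
Proof. by exists (Num.truncn x); apply/ltW; exact: truncnS_gt. Qed.

(** Read as a vector, this is [2 ((a + 1)/2 - 1/2)], which is [a] measured from 0 rather than from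
    the centre. *)
Definition emb a : V := cls (2, mid a mvone).

Lemma contr_mid1 x a : 0 <= x -> x <= 2^-1 ->
  contr (2 * x) (mid a mvone) = sc x a + ghalf.
Proof.
move=> x0 x1; rewrite contr_ge0; [|lra..].
rewrite /mid scDr ?half_orth // !scA; [|apply/andP; split; lra..].
rewrite -addrA -scDl; [|lra..].
by rewrite /ghalf; congr (sc _ _ + sc _ _); field.
Qed.

(** Levels of embedded elements are shrunk copies translated by the centre. Translation and
    shrinking both reflect the order, so comparing images reduces to comparing elements. *)
Lemma lvl_emb N a : 2 <= N -> lvl N (2, mid a mvone) = sc N^-1 a + ghalf.
Proof.
move=> N2; rewrite /lvl /= contr_mid1 //; first by rewrite invr_ge0; lra.
by rewrite lef_pV2 ?posrE //; lra.
Qed.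

Lemma scale_ghalf_orth N a : 2 <= N -> mvorth (sc N^-1 a) ghalf.
Proof.
move=> N2; have Ni : N^-1 <= 2^-1 by rewrite lef_pV2 ?posrE //; lra.
by apply: sc_orth; [rewrite invr_ge0|..]; lra.
Qed.

Lemma emb_le a b : (emb a <= emb b) = mvle a b.
Proof.
apply/idP/idP => [/vleP h|ab].
  have [N _ NP] := evtI h (evt_ge 2); have [] := NP N (lexx N).
  move=> + N2; rewrite !lvl_emb // => /(mvle_add2r (scale_ghalf_orth a N2)).
  by apply: sc_inj_le; rewrite invr_gt0; lra.
apply/vleP; apply: evt_imp (evt_ge 2) => N N2.
by rewrite !lvl_emb // mvle_add ?mvle_refl // sc_le.
Qed.

Lemma emb_inj : injective emb.
Proof. by move=> a b e; apply: mvle_anti; rewrite -emb_le e lexx. Qed.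

Lemma embD a b : mvorth a b -> emb (a + b) = emb a + emb b.
Proof.
move=> ab; rewrite [RHS]vaddE; apply/clsP.
have := evtI (evt_ge 4) (lvl_gadd (2, mid a mvone) (2, mid b mvone)).
apply: evt_imp => N [N4 ->]; rewrite !lvl_emb; [|lra..].
have Ni : (N / 2)^-1 <= 2^-1 by rewrite lef_pV2 ?posrE //; lra.
have Ni0 : 0 <= (N / 2)^-1 by rewrite invr_ge0; lra.
have N2 : 2 <= N / 2 by lra.
rewrite /mid !scDr ?scale_ghalf_orth //.
rewrite /ghalf !scA; [|apply/andP; split; lra..].
rewrite addrACA -[sc _ mvone + _]scDl; [|lra..].
have -> : 2^-1 * (N / 2)^-1 = N^-1 by field; apply: lt0r_neq0; lra.
by congr (_ + sc _ _); field.
Qed.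

Lemma embZ x a : 0 <= x <= 1 -> emb (sc x a) = x *: emb a.
Proof.
move=> x01; rewrite [RHS]vscaleE; apply/clsP.
apply: evt_imp (evt_ge 2) => N N2; rewrite lvl_emb //.
have Ni : N^-1 <= 2^-1 by rewrite lef_pV2 ?posrE //; lra.
have Ni0 : 0 <= N^-1 by rewrite invr_ge0; lra.
have xN : N^-1 * x <= N^-1 by rewrite ler_piMr //; case/andP: x01.
have xN0 : 0 <= N^-1 * x by rewrite mulr_ge0 //; case/andP: x01.
rewrite scA //; last by apply/andP; split; lra.
rewrite /lvl /= -contr_mid1 //; first by congr contr; field; apply: lt0r_neq0; lra.
by lra.
Qed.

Lemma emb0 : emb 0 = 0.
Proof. by rewrite -(sc0l (0 : A)) embZ ?scale0r // lexx ler01. Qed.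

Lemma emb_ge0 a : 0 <= emb a. Proof. by rewrite -emb0 emb_le mvle0. Qed.

Lemma emb_le1 a : emb a <= emb mvone. Proof. by rewrite emb_le mvle1. Qed.

Lemma sc_mulrn (n k : nat) a : (k <= n.+1)%N ->
  sc n.+1%:R^-1 a *+ k = sc (k%:R / n.+1%:R) a.
Proof.
elim: k => [|k ih] kn; first by rewrite mulr0n mul0r sc0l.
rewrite (mulrSr (sc _ a)) ih ?(ltnW kn) // -[k.+1%:R]natr1 mulrDl mul1r scDl ?divr_ge0 ?invr_ge0 //.
by rewrite -[X in _ + X]mul1r -mulrDl natr1 ler_pdivrMr // mul1r ler_nat.
Qed.

(** The weight bound prevents truncation in the iterated sum, so scaling distributes over it and
    undoes it. *)
Lemma sc_natmul (n : nat) a : weight_le (n.+1%:R^-1 : R) a ->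
  sc (n.+1%:R^-1) (a *+ n.+1) = a.
Proof.
move=> aw.
have h (k : nat) : (k <= n.+1)%N ->
    weight_le (k%:R / n.+1%:R : R) (a *+ k) /\
    sc (n.+1%:R^-1 : R) (a *+ k) = sc (n.+1%:R^-1 : R) a *+ k.
  elim: k => [|k ih] kn.
    by rewrite !mulr0n sc0r mul0r /weight_le mvle0.
  have k1 : k%:R / n.+1%:R + n.+1%:R^-1 <= 1 :> R.
    by rewrite -[X in _ + X]mul1r -mulrDl natr1 ler_pdivrMr // mul1r ler_nat.
  have k0 : 0 <= k%:R / n.+1%:R :> R by rewrite divr_ge0.
  have n0 : 0 <= n.+1%:R^-1 :> R by rewrite invr_ge0.
  have [kw ke] := ih (ltnW kn); split.
    by rewrite -[k.+1%:R]natr1 mulrDl mul1r (mulrSr a) weightD.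
  by rewrite (mulrSr a) (mulrSr (sc _ a)) scDr ?ke // (weight_orth k0 n0 k1).
have [_ ->] := h n.+1 (leqnn _).
by rewrite sc_mulrn // divff ?sc1l // lt0r_neq0.
Qed.

(** At a large integer level [N], the vector minus the centre is a piece of weight [1/N]; its
    [N]-fold sum is the preimage. *)
Lemma emb_onto v : 0 <= v -> v <= emb mvone -> exists a, v = emb a.
Proof.
rewrite -(rpK v); move: (rp v) => p /vleP v0 /vleP v1.
have [M _ MP] := evtI (evtI (evt_ge 2) (evt_ge `|p.1|)) (evtI v0 v1).
have [n Mn] := nat_bound M; have [[N2 pN]] := MP _ Mn.
set N := n.+1%:R in N2 pN *; rewrite lvl_zero lvl_emb // => -[p0 p1].
pose d := mvsub (lvl N p) ghalf.
have dw : weight_le N^-1 d.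
  by rewrite /weight_le /d mvle_sub_add addrC.
exists (d *+ n.+1); apply/clsP.
(* Above [N] both levels are the same homothety applied to the levels at [N], so it suffices to
   compare them there. *)
apply: evt_imp (evt_ge N) => K NK.
have N0 : 0 < N by lra.
rewrite (lvl_ratio N0 NK pN) (@lvl_ratio _ _ _ _ (2, _) N0 NK).
  by rewrite lvl_emb // sc_natmul // mvsubK.
by rewrite /= ger0_norm.
Qed.

Lemma contr_le1 x a : `|x| <= 1 -> mvle (contr x a) (sc ((1 + `|x|) / 2) mvone).
Proof.
have h y b : 0 <= y -> y <= 1 -> mvle (contr y b) (sc ((1 + y) / 2) mvone).
  move=> y0 y1; have -> : (1 + y) / 2 = y + (1 - y) / 2 by field.
  rewrite scDl; [|lra..].
  by rewrite contr_ge0 // mvle_add ?mvle_refl // sc_le ?mvle1.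
have [x0|x0] := leP 0 x; first by rewrite ger0_norm //; apply: h.
rewrite -{2}[x]opprK contrN ltr0_norm // => x1.
by apply: h => //; lra.
Qed.

Lemma mid11 : mid mvone mvone = mvone :> A.
 
Proof.
rewrite /mid -scDl; [|lra..].
by rewrite (_ : 2^-1 + 2^-1 = 1) ?sc1l //; lra.
Qed.

Lemma emb_strong : strong_unit (emb mvone).
Proof.
split; first exact: emb_ge0.
move=> v; rewrite -(rpK v); move: (rp v) => p; have [n pn] := nat_bound `|p.1|; exists n.+1.
rewrite -scaler_nat [_ *: _]vscaleE; apply/vleP.
have p0 := normr_ge0 p.1.
have := evtI (evt_ge (2 * n.+1%:R)) (evtI (evt_norm p.1) (evt_ge `|p.1|)).
apply: evt_imp => N [nN [p1 pN]]; rewrite /lvl /= mid11.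
have n0 : 1 <= n.+1%:R :> R by rewrite ler1n.
have N0 : 0 < N by lra.
have nN1 : n.+1%:R * 2 / N <= 1 by rewrite ler_pdivrMr // mul1r mulrC.
have nN0 : 0 <= n.+1%:R * 2 / N by rewrite divr_ge0 //; lra.
(* Both sides are now compared through multiples of the unit: half of [1 + |p.1| / N] against half
   of [1 + 2 (n+1) / N]. *)
apply: mvle_trans (contr_le1 _ p1) _.
rewrite /contr mvneg1 sc0r addr0; apply: sc_lel; [|  |lra].
  by rewrite divr_ge0 // addr_ge0.
rewrite ler_pM2r ?invr_gt0 // lerD2l normrM normfV (gtr0_norm N0).
by rewrite ler_pM2r ?invr_gt0 //; lra.
Qed.

Lemma embN a : emb (mvneg a) = emb mvone - emb a.
Proof.
by rewrite -(mvadd_neg a) embD ?mvorth_neg // addrC addrA addNr add0r.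
Qed.

(** The meet taken in the envelope lies in the unit interval, hence is itself an image; it can then
    be compared inside [A]. *)
Lemma embI a b : emb (mvmeet a b) = emb a ⊓ emb b.
Proof.
apply: le_anti; rewrite riesz_lexI !emb_le mvle_meetl mvle_meetr /=.
have [|c c_ab] := @emb_onto (emb a ⊓ emb b) _ (le_trans (riesz_leIl _ _) (emb_le1 a)).
  by rewrite riesz_lexI !emb_ge0.
by rewrite c_ab emb_le mvle_meet -!emb_le -c_ab riesz_leIl riesz_leIr.
Qed.

(** The truncated sum is the untruncated sum of [a] and [mvsub (a + b) a], and the latter is the
    meet of [b] with the complement of [a]. *)
Lemma emb_add a b : emb (a + b) = emb mvone ⊓ (emb a + emb b).
Proof.
have ab := mvsubK (mvle_addr a b); rewrite -{1}ab embD; last first.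
  by rewrite mvorthC mvorth_sub ?mvle_addr.
rewrite mvsub_addl embI embN addrC riesz_addrI riesz_meetC.
by rewrite (addrC _ (_ - _)) subrK.
Qed.

End Embedding.

(** * Linear extension from the unit interval *)

Section RieszTheory.
Context {R : realType} {V : rieszSpaceType R}.
Implicit Types (x y z t u : V) (a b r s : R).

Lemma riesz_leD x y z t : x <= y -> z <= t -> x + z <= y + t.
Proof.
move=> xy zt; apply: (@le_trans _ _ (x + t)); first by rewrite riesz_leD2l.
by rewrite ![_ + t]addrC riesz_leD2l.
Qed.

Lemma riesz_scale_ge0 a x : 0 <= a -> 0 <= x -> 0 <= a *: x.
Proof. by move=> a0 x0; rewrite -(scaler0 V a) riesz_leZ2l. Qed.

Lemma riesz_leZ2r a b x : 0 <= x -> a <= b -> a *: x <= b *: x.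
Proof.
move=> x0 ab; rewrite -riesz_subr_ge0 -scalerBl.
by rewrite riesz_scale_ge0 // subr_ge0.
Qed.

Lemma riesz_leZV a x y : 0 < a -> (x <= a *: y) = (a^-1 *: x <= y).
Proof.
move=> a0; apply/idP/idP => h.
  have := @riesz_leZ2l _ _ a^-1 _ _ _ h.
  by rewrite scalerA mulVf ?gt_eqF // scale1r => ->//; rewrite invr_ge0 ltW.
have := @riesz_leZ2l _ _ a _ _ (ltW a0) h.
by rewrite scalerA mulfV ?gt_eqF // scale1r.
Qed.

Lemma riesz_scaleI a x y : 0 <= a -> a *: (x ⊓ y) = (a *: x) ⊓ (a *: y).
Proof.
move=> a0; apply: oppr_inj.
by rewrite riesz_oppI -!scalerN riesz_oppI riesz_scaleU.
Qed.

Lemma riesz_joinE x y : x ⊔ y = - (- x ⊓ - y).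
Proof. by rewrite riesz_oppI !opprK. Qed.

Lemma strong_unit_bound u x : strong_unit u -> exists2 r, 0 < r & x <= r *: u.
Proof.
move=> [u0 /(_ x) [n xn]]; exists n.+1%:R => //.
by rewrite (le_trans xn) // -scaler_nat riesz_leZ2r // ler_nat.
Qed.

Lemma strong_unit_bound2 u x y : strong_unit u ->
  exists r, [/\ 0 < r, x <= r *: u & y <= r *: u].
Proof.
move=> su; have [r r0 xr] := strong_unit_bound x su.
have [s s0 ys] := strong_unit_bound y su; exists (r + s); split.
- exact: addr_gt0.
- by rewrite (le_trans xr) // riesz_leZ2r ?(proj1 su) // lerDl ltW.
- by rewrite (le_trans ys) // riesz_leZ2r ?(proj1 su) // lerDr ltW.
Qed.

Lemma strong_unit_diff u x : strong_unit u ->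
  exists p q, [/\ 0 <= p, 0 <= q & x = p - q].
Proof.
move=> su; have [r r0 xr] := strong_unit_bound (- x) su.
exists (x + r *: u), (r *: u); split; last by rewrite addrK.
  by rewrite -(subrr x) riesz_leD2l.
by rewrite riesz_scale_ge0 ?(ltW r0) ?(proj1 su).
Qed.

Lemma unit_rescale u r x : 0 < r -> 0 <= x -> x <= r *: u ->
  [/\ 0 <= r^-1 *: x, r^-1 *: x <= u & x = r *: (r^-1 *: x)].
Proof.
move=> r0 x0 xr; split; first by rewrite riesz_scale_ge0 // invr_ge0 ltW.
  by rewrite -riesz_leZV.
by rewrite scalerA mulfV ?gt_eqF // scale1r.
Qed.

End RieszTheory.

Section LinearExtension.
Context {R : realType} {V : rieszSpaceType R} {W : lmodType R}.
Context {u : V} (su : strong_unit u).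

Lemma linear_additive (f : V -> W) : linear f -> {morph f : x y / x + y}.
Proof. by move=> fL x y; have := fL 1 x y; rewrite !scale1r. Qed.

Lemma linear_homogeneous (f : V -> W) a : linear f -> {morph f : x / a *: x}.
Proof.
move=> fL x; have f0 : f 0 = 0.
  by have := fL (-1) 0 0; rewrite !scaleN1r oppr0 addr0 addNr.
by have := fL a x 0; rewrite f0 !addr0.
Qed.

Lemma linear_sub (f : V -> W) : linear f -> {morph f : x y / x - y}.
Proof.
move=> fL x y.
by rewrite (linear_additive fL) -[- y]scaleN1r (linear_homogeneous _ fL) scaleN1r.
Qed.

Lemma linear_ext (f g : V -> W) : linear f -> linear g ->
  (forall x, 0 <= x -> x <= u -> f x = g x) -> f =1 g.
Proof.
move=> fL gL fg x; have [p [q [p0 q0 ->]]] := strong_unit_diff x su.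
have pos y : 0 <= y -> f y = g y.
  move=> y0; have [r r0 yr] := strong_unit_bound y su.
  have [ry0 ryu ->] := unit_rescale r0 y0 yr.
  by rewrite (linear_homogeneous _ fL) (linear_homogeneous _ gL) fg.
by rewrite (linear_sub fL) (linear_sub gL) !pos.
Qed.

Context (phi : V -> W).
Context (phiD : forall x y, 0 <= x -> 0 <= y -> x + y <= u ->
  phi (x + y) = phi x + phi y).
Context (phiZ : forall a x, 0 <= a <= 1 -> 0 <= x -> x <= u ->
  phi (a *: x) = a *: phi x).

(** The map is first extended to the positive cone by shrinking into the unit interval and scaling
    back, then to all of [V] through differences of positive elements. *)
Lemma linear_extension : exists2 f : V -> W, linear f &
  forall x, 0 <= x -> x <= u -> f x = phi x.
Proof.
have [b /all_and2[b0 bu]] : {b : V -> R & forall x, 0 < b x /\ x <= b x *: u}.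
  apply: (@choice _ _ (fun x r => 0 < r /\ x <= r *: u)) => x.
  by have [r ? ?] := strong_unit_bound x su; exists r.
pose psi x := b x *: phi ((b x)^-1 *: x).
(* The value does not depend on the shrinking factor: two factors differ by a scalar in [[0, 1]],
   for which [phi] is homogeneous. *)
have psi_le r s x : 0 < r -> r <= s -> 0 <= x -> x <= r *: u ->
    r *: phi (r^-1 *: x) = s *: phi (s^-1 *: x).
  move=> r0 rs x0 xr; have s0 := lt_le_trans r0 rs.
  have [rx0 rxu _] := unit_rescale r0 x0 xr.
  have -> : s^-1 *: x = (r / s) *: (r^-1 *: x).
    by rewrite scalerA; congr (_ *: _); field; rewrite !gt_eqF.
  have rs1 : 0 <= r / s <= 1.
    by rewrite divr_ge0 ?(ltW r0) ?(ltW s0) //= ler_pdivrMr ?mul1r.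
  rewrite phiZ // scalerA.
  by congr (_ *: _); field; rewrite gt_eqF.
have psiE r x : 0 < r -> 0 <= x -> x <= r *: u -> psi x = r *: phi (r^-1 *: x).
  move=> r0 x0 xr; have rb0 : 0 < r + b x by exact: addr_gt0.
  rewrite /psi (@psi_le (b x) (r + b x)) ?lerDr ?(ltW r0) //.
  by rewrite -(@psi_le r (r + b x)) ?lerDl ?(ltW (b0 x)).
have psiD x y : 0 <= x -> 0 <= y -> psi (x + y) = psi x + psi y.
  move=> x0 y0; have r0 := b0 (x + y); have xyr := bu (x + y).
  set r := b (x + y) in r0 xyr.
  have xr : x <= r *: u.
    by rewrite (le_trans _ xyr) // -[leLHS]addr0 riesz_leD2l.
  have yr : y <= r *: u.
    by rewrite (le_trans _ xyr) // addrC -[leLHS]addr0 riesz_leD2l.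
  rewrite !(@psiE r) ?riesz_addr_ge0 // scalerDr phiD ?scalerDr //.
  - by case: (unit_rescale r0 x0 xr).
  - by case: (unit_rescale r0 y0 yr).
  - by rewrite -scalerDr -riesz_leZV.
have psiZ a x : 0 <= a -> 0 <= x -> psi (a *: x) = a *: psi x.
  rewrite le_eqVlt => /predU1P[<- x0|a0 x0].
    rewrite !scale0r; have := psiD 0 0 (lexx _) (lexx _).
    by rewrite addr0 => /eqP; rewrite -subr_eq0 opprD addNKr oppr_eq0 => /eqP.
  have ab0 : 0 < a * b x by exact: mulr_gt0.
  rewrite (@psiE (a * b x)) ?riesz_scale_ge0 ?(ltW a0) //; last first.
    by rewrite -scalerA riesz_leZ2l ?(ltW a0).
  rewrite /psi !scalerA; congr (_ *: phi (_ *: _)); field.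
  by rewrite !gt_eqF.
(* The translation by [b (- x) *: u] makes the argument positive; additivity of [psi] shows that any
   other decomposition into positive parts gives the same value. *)
pose f x := psi (x + b (- x) *: u) - psi (b (- x) *: u).
have c0 x : 0 <= b x *: u by rewrite riesz_scale_ge0 ?(ltW (b0 _)) ?(proj1 su).
have xc0 x : 0 <= x + b (- x) *: u by rewrite -(subrr x) riesz_leD2l.
have fB p q : 0 <= p -> 0 <= q -> f (p - q) = psi p - psi q.
  move=> p0 q0; rewrite /f; set x := p - q; set c := b (- x) *: u.
  apply/eqP; rewrite subr_eq [_ - psi q + _]addrAC eq_sym subr_eq eq_sym -!psiD ?xc0 ?c0 //.
  by rewrite /x addrAC subrK.
have fP (x : V) : exists p q : V, [/\ 0 <= p, 0 <= q & x = p - q].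
  exact: (strong_unit_diff x su).
have fZ a x : f (a *: x) = a *: f x.
  have [p [q [p0 q0 ->]]] := fP x; rewrite scalerBr.
  have [a0|/ltW a0] := leP 0 a.
    by rewrite !fB ?riesz_scale_ge0 // !psiZ // scalerBr.
  have na0 : 0 <= - a by rewrite oppr_ge0.
  rewrite -[a *: p]opprK -[- (a *: q)]scaleNr -[- (a *: p)]scaleNr addrC.
  by rewrite !fB ?riesz_scale_ge0 // !psiZ // !scaleNr opprK addrC scalerBr.
exists f => [a x y|x x0 xu].
  rewrite -fZ; have [p [q [p0 q0 ->]]] := fP (a *: x).
  have [p' [q' [p'0 q'0 ->]]] := fP y.
  by rewrite addrACA -opprD !fB ?riesz_addr_ge0 // !psiD // opprD addrACA.
rewrite -[x]subr0 fB // -(scale0r u) psiZ ?(proj1 su) // scale0r subr0.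
by rewrite scale0r subr0 (@psiE 1) ?scale1r // invr1 !scale1r.
Qed.

End LinearExtension.

(** * The product of the enveloping f-algebra *)

Section PartialProduct.
Context {A : pmvfAlgType}.
Implicit Types a b c : A.

Lemma pmul_sub a b c : mvle b a ->
  pmul c (mvsub a b) = mvsub (pmul c a) (pmul c b).
Proof.
by move=> ba; have := pmulBr a b c; rewrite mvmeetC (mvmeet_l ba) !mvmulE.
Qed.

Lemma pmul_subl a b c : mvle b a ->
  pmul (mvsub a b) c = mvsub (pmul a c) (pmul b c).
Proof.
by move=> ba; have := pmulBl a b c; rewrite mvmeetC (mvmeet_l ba) !mvmulE.
Qed.

Lemma mvsub_subK a b : mvle b a -> mvsub a (mvsub a b) = b.
Proof. by move=> ba; rewrite -mvmeetE mvmeetC mvmeet_l. Qed.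

Lemma pmul_le a b c : mvle b a -> mvle (pmul c b) (pmul c a).
Proof.
by move=> ba; rewrite -{1}(mvsub_subK ba) pmul_sub ?mvsub_le.
Qed.

Lemma pmul_lel a b c : mvle b a -> mvle (pmul b c) (pmul a c).
Proof.
by move=> ba; rewrite -{1}(mvsub_subK ba) pmul_subl ?mvsub_le.
Qed.

(** The product with [a] is the product with [a + b] minus the product with [b], and such a
    difference is orthogonal to what was subtracted. *)
Lemma pmul_orth a b c : mvorth a b -> mvorth (pmul c a) (pmul c b).
Proof.
move=> ab; rewrite -{1}(mvaddK ab) pmul_sub ?mvle_addl // mvorthC.
by rewrite mvorth_sub // pmul_le // mvle_addl.
Qed.

Lemma pmul_orthl a b c : mvorth a b -> mvorth (pmul a c) (pmul b c).
Proof.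
move=> ab; rewrite -{1}(mvaddK ab) pmul_subl ?mvle_addl // mvorthC.
by rewrite mvorth_sub // pmul_lel // mvle_addl.
Qed.

Lemma pmulD a b c : mvorth a b -> pmul c (a + b) = pmul c a + pmul c b.
Proof.
move=> ab; rewrite -{2}(mvaddK ab) pmul_sub ?mvle_addl //.
by rewrite mvsubK // pmul_le // mvle_addl.
Qed.

Lemma pmulDl a b c : mvorth a b -> pmul (a + b) c = pmul a c + pmul b c.
Proof.
move=> ab; rewrite -{2}(mvaddK ab) pmul_subl ?mvle_addl //.
by rewrite mvsubK // pmul_lel // mvle_addl.
Qed.

End PartialProduct.

(** * Bilinear extension of the product to the envelope *)

Section Product.
Context {R : realType} {A : fmvAlgType R}.
Local Notation V := (envelope A).
Local Notation u := (emb mvone : V).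
Implicit Types (x y z v w : V) (a b c : A) (r s : R).

Lemma emb_orth a b : emb a + emb b <= u -> mvorth a b.
Proof.
rewrite /mvorth -emb_le (embN b) => h.
by rewrite -(riesz_leD2lE (emb b)) addrC [leRHS]addrC subrK.
Qed.

Lemma emb_linear_ext (W : lmodType R) (f g : V -> W) : linear f -> linear g ->
  (forall a, f (emb a) = g (emb a)) -> f =1 g.
Proof.
move=> fL gL fg; apply: (linear_ext emb_strong fL gL) => x x0 xu.
by have [a ->] := emb_onto x0 xu.
Qed.

(** Linear extension with the data given on [A] itself, carried to the unit interval by a chosen
    section [g] of [emb]. *)
Lemma emb_extension (W : lmodType R) (phi : A -> W) :
  (forall a b, mvorth a b -> phi (a + b) = phi a + phi b) ->
  (forall r a, 0 <= r <= 1 -> phi (sc r a) = r *: phi a) ->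
  exists f : V -> W, linear f /\ forall a, f (emb a) = phi a.
Proof.
move=> phiD phiZ.
have [g gK] : {g : V -> A & forall v, (exists a, v = emb a) -> emb (g v) = v}.
  apply: (@choice _ _ (fun v a => (exists a, v = emb a) -> emb a = v)) => v.
  by have [[a ->]|h] := pselect (exists a, v = emb a); [exists a|exists 0].
have embK a : g (emb a) = a by apply: emb_inj; rewrite gK //; exists a.
have [||f fL fphi] := @linear_extension _ _ W _ emb_strong (phi \o g).
- move=> x y x0 y0 xyu.
  have xu : x <= u by rewrite (le_trans _ xyu) // -[leLHS]addr0 riesz_leD2l.
  have yu : y <= u by rewrite (le_trans _ xyu) // -[leLHS]add0r riesz_leD.
  have [a xa] := emb_onto x0 xu; have [b yb] := emb_onto y0 yu.
  rewrite xa yb in xyu *; have ab := emb_orth xyu.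
  by rewrite -embD //= !embK phiD.
- move=> r x r01 x0 xu; have [a ->] := emb_onto x0 xu.
  by rewrite -embZ //= !embK phiZ.
exists f; split=> // a; rewrite fphi ?emb_ge0 ?emb_le1 //=.
by rewrite embK.
Qed.

Lemma mvscaleE (r : {i01 R}) a : mvscale r a = sc r%:num a.
Proof. by rewrite /sc clamp_num. Qed.

Lemma pmul_sc r a b : pmul a (sc r b) = sc r (pmul a b).
Proof. by rewrite /sc -mvscale_pmulr. Qed.

Lemma pmul_scl r a b : pmul (sc r a) b = sc r (pmul a b).
Proof. by rewrite /sc -mvscale_pmull. Qed.

Lemma linear_comb (U W : lmodType R) (f g : U -> W) r :
  linear f -> linear g -> linear (fun x : U => r *: f x + g x).
Proof.
move=> fL gL k x y; rewrite fL gL !scalerDr !scalerA (mulrC r).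
by rewrite addrACA.
Qed.

(** The right factor is extended first, for a left factor in [A]. Uniqueness of linear extensions
    shows that the result is additive and homogeneous in that left factor, which can then be
    extended too. *)
Lemma product_exists : exists m : V -> V -> V,
  [/\ forall w, linear (m w), forall v, linear (m^~ v) &
      forall a b, m (emb a) (emb b) = emb (pmul a b)].
Proof.
have [L /all_and2[LL LE]] : {L : A -> V -> V &
    forall a, linear (L a) /\ forall b, L a (emb b) = emb (pmul a b)}.
  apply: (@choice _ _ (fun a f => linear f /\
    forall b, f (emb b) = emb (pmul a b))) => a.
  apply: emb_extension => [b c bc|r b r01].
    by rewrite pmulD // embD // pmul_orth.
  by rewrite pmul_sc embZ.
have [M /all_and2[ML ME]] : {M : V -> V -> V &
    forall v, linear (M v) /\ forall a, M v (emb a) = L a v}.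
  apply: (@choice _ _ (fun v f => linear f /\
    forall a, f (emb a) = L a v)) => v.
  apply: emb_extension => [a b ab|r a r01].
    rewrite -[L a v]scale1r.
    apply: (emb_linear_ext (LL _) (linear_comb 1 (LL a) (LL b))) => c.
    by rewrite !LE scale1r pmulDl // embD // pmul_orthl.
  (* The multiple [r *: L a v] is written as a combination with a zero second term, so that
     [linear_comb] applies. *)
  rewrite -[RHS]addr0 -{1}(scale0r (L a v)).
  have zL : linear (fun x : V => 0 *: L a x).
    by move=> k x y; rewrite !scale0r scaler0 addr0.
  apply: (emb_linear_ext (LL _) (linear_comb r (LL a) zL)) => c.
  by rewrite !LE scale0r addr0 pmul_scl embZ.
(* [M] takes the right factor first, so its arguments are exchanged. *)
exists (fun w v => M v w); split => [w k v v'|//|a b]; last by rewrite ME LE.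
have kL := linear_comb k (ML v) (ML v').
apply: (emb_linear_ext (ML _) kL) => a.
by rewrite !ME LL.
Qed.

Definition vmul : V -> V -> V := projT1 (cid product_exists).

Lemma vmul_linear x : linear (vmul x).
Proof. by rewrite /vmul; case: cid => ? []. Qed.

Lemma vmul_linearl x : linear (vmul^~ x).
Proof. by rewrite /vmul; case: cid => ? []. Qed.

Lemma vmul_emb a b : vmul (emb a) (emb b) = emb (pmul a b).
Proof. by rewrite /vmul; case: cid => ? []. Qed.

Lemma vmulDl : left_distributive vmul +%R.
Proof. by move=> x y z; exact: (linear_additive (vmul_linearl z)). Qed.

Lemma vmulDr : right_distributive vmul +%R.
Proof. by move=> x y z; exact: (linear_additive (vmul_linear x)). Qed.

Lemma vmulZl r x y : r *: vmul x y = vmul (r *: x) y.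
Proof. by rewrite -(linear_homogeneous _ (vmul_linearl y)). Qed.

Lemma vmulZr r x y : r *: vmul x y = vmul x (r *: y).
Proof. by rewrite (linear_homogeneous _ (vmul_linear x)). Qed.

(** Both sides are linear in each variable, so the variables are replaced one at a time by elements
    of [A]. *)
Lemma vmulA : associative vmul.
Proof.
move=> x y z.
have h1 : linear (fun x => vmul (vmul x y) z).
  by move=> k ? ?; rewrite vmulDl -vmulZl vmulDl -vmulZl.
apply: (emb_linear_ext (vmul_linearl _) h1) => a {x h1}.
have h1 : linear (fun y => vmul (emb a) (vmul y z)).
  by move=> k ? ?; rewrite vmulDl -vmulZl vmulDr -vmulZr.
have h2 : linear (fun y => vmul (vmul (emb a) y) z).
  by move=> k ? ?; rewrite vmulDr -vmulZr vmulDl -vmulZl.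
apply: (emb_linear_ext h1 h2) => b {y h1 h2}.
have h1 : linear (fun z => vmul (emb a) (vmul (emb b) z)).
  by move=> k ? ?; rewrite vmulDr -vmulZr vmulDr -vmulZr.
apply: (emb_linear_ext h1 (vmul_linear _)) => c {z h1}.
by rewrite !vmul_emb pmulA.
Qed.

Lemma emb_rescale r x : 0 < r -> 0 <= x -> x <= r *: u ->
  exists a, x = r *: emb a.
Proof.
move=> r0 x0 xr; have [rx0 rxu ->] := unit_rescale r0 x0 xr.
by have [a ->] := emb_onto rx0 rxu; exists a.
Qed.

Lemma vmul_ge0 x y : 0 <= x -> 0 <= y -> 0 <= vmul x y.
Proof.
move=> x0 y0; have [r [r0 xr yr]] := strong_unit_bound2 x y emb_strong.
have [a ->] := emb_rescale r0 x0 xr; have [b ->] := emb_rescale r0 y0 yr.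
by rewrite -vmulZl -vmulZr vmul_emb !riesz_scale_ge0 ?(ltW r0) ?emb_ge0.
Qed.

Lemma disjoint_rescale x y z : x ⊓ y = 0 -> 0 <= z ->
  exists r s a b c, [/\ 0 < r, 1 <= s, x = r *: emb a, y = r *: emb b &
    z = s *: emb c] /\ mvmeet a b = 0.
Proof.
move=> xy z0; have x0 : 0 <= x by rewrite -xy riesz_leIl.
have y0 : 0 <= y by rewrite -xy riesz_leIr.
have [r [r0 xr yr]] := strong_unit_bound2 x y emb_strong.
have [a xa] := emb_rescale r0 x0 xr; have [b yb] := emb_rescale r0 y0 yr.
have [s s0 zs] := strong_unit_bound z emb_strong.
(* The bound is raised to [1 + s] so that the scale of [z] is at least 1, as [disjoint_scale]
   requires. *)
have s10 : 0 < 1 + s by rewrite addr_gt0.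
have zs1 : z <= (1 + s) *: u.
  by rewrite (le_trans zs) // riesz_leZ2r ?emb_ge0 // lerDr.
have [c zc] := emb_rescale s10 z0 zs1.
exists r, (1 + s), a, b, c; split; first by split; rewrite ?lerDl ?(ltW s0).
apply: emb_inj; rewrite embI emb0 -[LHS]scale1r -(mulVf (lt0r_neq0 r0)).
by rewrite -scalerA riesz_scaleI ?(ltW r0) // -xa -yb xy scaler0.
Qed.

Lemma disjoint_le x y v w : x ⊓ y = 0 -> 0 <= v -> v <= x -> 0 <= w -> w <= y ->
  v ⊓ w = 0.
Proof.
move=> xy v0 vx w0 wy; apply: le_anti; rewrite riesz_lexI v0 w0 !andbT.
by rewrite -xy riesz_lexI (le_trans (riesz_leIl _ _) vx)
  (le_trans (riesz_leIr _ _) wy).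
Qed.

(** As [s] is at least 1, enlarging the second factor to scale [r * s] dominates it; a common scale
    preserves disjointness. *)
Lemma disjoint_scale r s a b : 0 < r -> 1 <= s -> mvmeet a b = 0 ->
  ((r * s) *: emb a) ⊓ (r *: emb b) = 0.
Proof.
move=> r0 s1 ab; have rs0 : 0 <= r * s by rewrite mulr_ge0 ?(ltW r0) //; lra.
apply: (@disjoint_le ((r * s) *: emb a) ((r * s) *: emb b)) => //.
- by rewrite -riesz_scaleI // -embI ab emb0 scaler0.
- by rewrite riesz_scale_ge0 ?emb_ge0.
- by rewrite riesz_scale_ge0 ?emb_ge0 ?(ltW r0).
- by rewrite riesz_leZ2r ?emb_ge0 // ler_peMr // (ltW r0).
Qed.

Lemma vmul_disjointr x y z : x ⊓ y = 0 -> 0 <= z -> vmul x z ⊓ y = 0.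
Proof.
move=> xy z0.
have [r [s [a [b [c [[r0 s1 -> -> ->] ab]]]]]] := disjoint_rescale xy z0.
by rewrite -vmulZl -vmulZr vmul_emb scalerA disjoint_scale // pmul_disjointr.
Qed.

Lemma vmul_disjointl x y z : x ⊓ y = 0 -> 0 <= z -> vmul z x ⊓ y = 0.
Proof.
move=> xy z0.
have [r [s [a [b [c [[r0 s1 -> -> ->] ab]]]]]] := disjoint_rescale xy z0.
by rewrite -vmulZl -vmulZr vmul_emb scalerA mulrC disjoint_scale // pmul_disjointl.
Qed.

HB.instance Definition _ := RieszSpace_isFAlgebra.Build R V
  vmulA vmulDl vmulDr vmulZl vmulZr vmul_ge0 vmul_disjointr vmul_disjointl.

Lemma emb1_sqr : fmul u u <= u.
Proof. by rewrite [fmul _ _]vmul_emb emb_le1. Qed.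

End Product.

Definition fu_envelope (R : realType) (A : fmvAlgType R) : fuAlg R :=
  @FuAlg R (envelope A) (emb mvone) emb_strong emb1_sqr.

Lemma emb_bounds (R : realType) (A : fmvAlgType R) (a : A) :
  (0 <= emb a) && (emb a <= fu_unit (fu_envelope A)).
Proof. by rewrite emb_ge0 emb_le1. Qed.

Definition ui_emb (R : realType) (A : fmvAlgType R) (a : A) :
  unit_interval (fu_envelope A) :=
  @UnitInterval R (fu_envelope A) (emb a) (emb_bounds a).

Lemma ui_emb_hom (R : realType) (A : fmvAlgType R) :
  exists f : fmv_hom A (unit_interval (fu_envelope A)), f =1 @ui_emb R A.
Proof.
have eD : {morph @ui_emb R A : a b / a + b}.
  by move=> a b; apply: ui_val_inj; exact: emb_add.
have eM : {morph @ui_emb R A : a b / pmul a b}.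
  by move=> a b; apply: ui_val_inj; apply/esym; exact: vmul_emb.
have eN : {morph @ui_emb R A : a / mvneg a}.
  by move=> a; apply: ui_val_inj; exact: embN.
have eZ (r : {i01 R}) : {morph @ui_emb R A : a / mvscale r a}.
  by move=> a; apply: ui_val_inj; rewrite mvscaleE; apply: embZ; rewrite ge0 le1.
have e0 : @ui_emb R A 0 = 0 by apply: ui_val_inj; exact: emb0.
by exists (FMVHom eD eM eN eZ e0).
Qed.

Lemma ui_emb_inj (R : realType) (A : fmvAlgType R) : injective (@ui_emb R A).
Proof. by move=> a b /(congr1 (@ui_val _ _)); exact: emb_inj. Qed.

Lemma ui_emb_onto (R : realType) (A : fmvAlgType R)
  (x : unit_interval (fu_envelope A)) : exists a, x = ui_emb a.
Proof.
have [a xa] := emb_onto (ui_ge0 x) (ui_le1 x).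
by exists a; apply: ui_val_inj.
Qed.

(** * The equivalence *)

Lemma fmv_mapI (R : realType) (A B : fmvAlgType R) (f : fmv_hom A B) :
  {morph f : a b / mvmeet a b}.
Proof.
by move=> a b; rewrite /mvmeet /mvmul !(fmv_mapN, fmv_mapD).
Qed.

Lemma fmv_map_bij_inv (R : realType) (A B : fmvAlgType R) (f : fmv_hom A B) :
  injective f -> (forall b, exists a, b = f a) ->
  exists g : fmv_hom B A, cancel f g /\ cancel g f.
Proof.
move=> finj fonto; have [g gK] := choice fonto.
have fK a : g (f a) = a by apply: finj; rewrite -gK.
have gD : {morph g : x y / x + y}.
  by move=> x y; apply: finj; rewrite fmv_mapD -!gK.
have gM : {morph g : x y / pmul x y}.
  by move=> x y; apply: finj; rewrite fmv_mapM -!gK.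
have gN : {morph g : x / mvneg x}.
  by move=> x; apply: finj; rewrite fmv_mapN -!gK.
have gZ (a : {i01 R}) : {morph g : x / mvscale a x}.
  by move=> x; apply: finj; rewrite fmv_mapZ -!gK.
have g0 : g 0 = 0 by apply: finj; rewrite fmv_map0 -!gK.
by exists (FMVHom gD gM gN gZ g0); split=> [//|b] /=; rewrite -gK.
Qed.

(** * Fullness and faithfulness of [Gamma_f] *)

Section GammaFullyFaithful.
Context {R : realType} {V W : fuAlg R}.

Lemma ui_valD (x y : unit_interval V) : ui_val x + ui_val y <= fu_unit V ->
  ui_val (x + y) = ui_val x + ui_val y.
Proof. by move=> xy; rewrite /= riesz_meet_r. Qed.

Lemma ui_of (x : V) : 0 <= x -> x <= fu_unit V ->
  exists y : unit_interval V, x = ui_val y.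
Proof. by move=> x0 x1; have x01 := introT andP (conj x0 x1); exists (UnitInterval x01). Qed.

Lemma Gamma_faithful (f g : fu_hom V W) :
  Gamma_f_hom f = Gamma_f_hom g -> f = g.
Proof.
move=> fg; apply/fu_hom_ext/funext.
apply: (linear_ext (fu_unit_strong V) (fu_map_linear f) (fu_map_linear g)).
move=> x x0 x1; have [y ->] := ui_of x0 x1.
by have := congr1 (fun h : fmv_hom _ _ => ui_val (h y)) fg.
Qed.

Lemma Gamma_extend (phi : fmv_hom (unit_interval V) (unit_interval W)) :
  exists f : V -> W, linear f /\ forall y, f (ui_val y) = ui_val (phi y).
Proof.
(* The value 0 outside the unit interval is a mere default. *)
pose psi (x : V) : W := if insub x is Some y then ui_val (phi y) else 0.
have psiE y : psi (ui_val y) = ui_val (phi y) by rewrite /psi valK.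
have [||f fL fpsi] := @linear_extension _ V W _ (fu_unit_strong V) psi.
- move=> x y x0 y0 xyu.
  have xu : x <= fu_unit V by rewrite (le_trans _ xyu) // -[leLHS]addr0 riesz_leD.
  have yu : y <= fu_unit V by rewrite (le_trans _ xyu) // -[leLHS]add0r riesz_leD.
  have [a xa] := ui_of x0 xu; have [b yb] := ui_of y0 yu.
  rewrite xa yb in xyu *; rewrite -ui_valD // !psiE fmv_mapD /= riesz_meet_r //.
  (* That the sum stays below the unit is expressed by an equation between MV-operations, which
     [phi] preserves; hence the sum of the images is not truncated either. *)
  have ab : mvmul a b = 0.
    apply: ui_val_inj; rewrite ui_val_mvmul riesz_joinC riesz_join_r //.
    by rewrite opprB addrA -(riesz_leD2lE (fu_unit V)) addr0 subrKC.
  have := congr1 phi ab; rewrite /mvmul !(fmv_mapN, fmv_mapD, fmv_map0).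
  move/(congr1 (@ui_val _ _)); rewrite -/(mvmul _ _) ui_val_mvmul => h.
  have := riesz_leUr 0 (ui_val (phi a) - (fu_unit W - ui_val (phi b))).
  by rewrite h opprB addrA -(riesz_leD2lE (fu_unit W)) addr0 subrKC.
- move=> r x /andP[r0 r1] x0 x1; have [a ->] := ui_of x0 x1.
  have -> : r *: ui_val a = ui_val (mvscale (Itv01 r0 r1) a) by [].
  by rewrite !psiE fmv_mapZ.
exists f; split=> // y; rewrite fpsi ?ui_ge0 ?ui_le1 //.
Qed.

Lemma Gamma_full (phi : fmv_hom (unit_interval V) (unit_interval W)) :
  exists f : fu_hom V W, Gamma_f_hom f = phi.
Proof.
have [f [fL fphi]] := Gamma_extend phi.
have fD := linear_additive fL.
have fB := linear_sub fL.
have fZ r := linear_homogeneous r fL.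
have f0 : f 0 = 0 by rewrite -(subrr 0) fB subrr.
have fN x : f (- x) = - f x by rewrite -[- x]sub0r fB f0 sub0r.
have rescale (x y : V) : 0 <= x -> 0 <= y -> exists r a b,
    [/\ 0 < r, x = r *: ui_val a & y = r *: @ui_val _ V b].
  move=> x0 y0; have [r [r0 xr yr]] := strong_unit_bound2 x y (fu_unit_strong V).
  have [x0' x1' ->] := unit_rescale r0 x0 xr.
  have [y0' y1' ->] := unit_rescale r0 y0 yr.
  have [a ->] := ui_of x0' x1'; have [b ->] := ui_of y0' y1'.
  by exists r, a, b.
have fI : {morph f : x y / x ⊓ y}.
  have posI x y : 0 <= x -> 0 <= y -> f (x ⊓ y) = f x ⊓ f y.
    move=> x0 y0; have [r [a [b [r0 -> ->]]]] := rescale x y x0 y0.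
    rewrite -riesz_scaleI ?(ltW r0) // !fZ -ui_valI !fphi fmv_mapI ui_valI.
    by rewrite riesz_scaleI ?(ltW r0).
  move=> x y.
  have [r [r0 xr yr]] := strong_unit_bound2 (- x) (- y) (fu_unit_strong V).
  (* Adding [c] makes both arguments positive, and meets commute with translations. *)
  set c := r *: _ in xr yr.
  have cx : 0 <= c + x by rewrite -(addNr x) addrC [leRHS]addrC riesz_leD2l.
  have cy : 0 <= c + y by rewrite -(addNr y) addrC [leRHS]addrC riesz_leD2l.
  rewrite -(addKr c (x ⊓ y)) riesz_addrI fD posI // !fD fN.
  by rewrite riesz_addrI !addKr.
have fU : {morph f : x y / x ⊔ y}.
  by move=> x y; rewrite !riesz_joinE fN fI !fN.
have fM : {morph f : x y / fmul x y}.
  have posM x y : 0 <= x -> 0 <= y -> f (fmul x y) = fmul (f x) (f y).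
    move=> x0 y0; have [r [a [b [r0 -> ->]]]] := rescale x y x0 y0.
    rewrite -!fmulZl -!fmulZr !fZ -!fmulZl -!fmulZr -ui_valM !fphi.
    by rewrite fmv_mapM.
  move=> x y; have [p [q [p0 q0 ->]]] := strong_unit_diff x (fu_unit_strong V).
  have [p' [q' [p'0 q'0 ->]]] := strong_unit_diff y (fu_unit_strong V).
  by rewrite !fB !fmulBl !fmulBr !fB !posM.
have fu : f (fu_unit V) = fu_unit W.
  have := fphi (mvneg 0); rewrite fmv_mapN fmv_map0 /= !subr0 => <- //.
exists (FuHom fL fI fU fM fu); apply/fmv_hom_ext/funext => x.
by apply: ui_val_inj; rewrite /= fphi.
Qed.

End GammaFullyFaithful.

(** Choice selects for each object of [D] a preimage up to isomorphism; fullness lifts morphisms,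
    and faithfulness turns every identity to be checked in [C] into one in [D]. *)
Lemma equivalence_criterion (C D : category) (F : functor C D) :
  (forall a b (f g : @hom C a b), fmap F f = fmap F g -> f = g) ->
  (forall a b (h : @hom D (F a) (F b)), exists f, fmap F f = h) ->
  (forall d : D, exists (c : C) (e : hom (F c) d), is_iso e) ->
  is_equivalence F.
Proof.
move=> faithful full esurj.
have lift a b h := cid (full a b h).
pose L a b h : hom a b := sval (lift a b h).
have LK a b h : fmap F (L a b h) = h by exact: (svalP (lift a b h)).
have esurj' d : {c : C & {e : hom (F c) d & {i : hom d (F c) |
    comp i e = idm (F c) /\ comp e i = idm d}}}.
  by have [c /cid[e /cid[i ie]]] := cid (esurj d); exists c, e, i.
pose G0 d := projT1 (esurj' d).
pose e d : hom (F (G0 d)) d := projT1 (projT2 (esurj' d)).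
pose i d : hom d (F (G0 d)) := sval (projT2 (projT2 (esurj' d))).
have [ie ei] : (forall d, comp (i d) (e d) = idm _) /\
    (forall d, comp (e d) (i d) = idm _).
  by split=> d; rewrite /i; case: (projT2 (projT2 (esurj' d))) => ? [].
(* A morphism is conjugated by the chosen isomorphisms, then lifted along [F]. *)
pose G1 d d' (f : hom d d') := L _ _ (comp (i d') (comp f (e d))).
have G11 d : G1 d d (idm d) = idm (G0 d).
  by apply: faithful; rewrite LK comp1m ie fmap1.
have G1c a b c (g : hom b c) (f : hom a b) :
    G1 _ _ (comp g f) = comp (G1 _ _ g) (G1 _ _ f).
  apply: faithful; rewrite fmap_comp !LK -!compmA; congr (comp (i c) (comp g _)).
  by rewrite [RHS]compmA ei comp1m.
exists (Functor G11 G1c); split.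
  (* The unit lifts the inverse isomorphism [i (F a)], and its own inverse lifts [e (F a)]. *)
  exists (fun a => L a (G0 (F a)) (i (F a))); split=> [a|a b f].
    exists (L (G0 (F a)) a (e (F a))).
    by split; apply: faithful; rewrite fmap_comp !LK ?ie ?ei fmap1.
  apply: faithful; rewrite !fmap_comp !LK /= -!compmA ei.
  by rewrite compm1.
exists e; split=> [d|a b f]; first by exists (i d); split; [exact: ie|exact: ei].
by rewrite /= LK compmA ei comp1m.
Qed.

Theorem theorem2p9 (R : realType) : is_equivalence (Gamma_f R).
Proof.
apply: equivalence_criterion => [V W f g|V W h|A].
- exact: Gamma_faithful.
- exact: Gamma_full.
(* Essential surjectivity: [A] is isomorphic to the unit interval of its envelope. *)
have [f fE] := ui_emb_hom A.
have [||g [fK gK]] := @fmv_map_bij_inv _ _ _ f.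
- by move=> a b; rewrite !fE; exact: ui_emb_inj.
- by move=> x; have [a ->] := ui_emb_onto x; exists a; rewrite fE.
exists (fu_envelope A), g, f.
by split; apply/fmv_hom_ext/funext.
Qed.
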